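(* Fix a compact set $\mathcal P\subset(0,1)$. For $p\in\mathcal P$, $q=1-p$ and real $r>0$, let $X\sim\mathrm{NB}(r,p)$ with mean $\mu=rq/p$ and variance $\sigma^2=rq/p^2$, and put $\nu=\lceil\mu\rceil$, $h=\nu-\mu\in[0,1)$. For $n\ge1$ define $$\tilde a_n=\tilde a_n(h;p)=\frac{(-1)^{n+1}}{n(n+1)}\Bigl[\bigl(p^n-(p/q)^n\bigr)B_{n+1}(h)-B_{n+1}\Bigr].$$ Then, as $r\to\infty$ through the reals, uniformly for $p\in\mathcal P$ and uniformly in the displacement $h\in[0,1)$, $$\mathbb E|X-\mu|\sim\frac1p\sqrt{\frac{2rq}{\pi}}\;\exp\Bigl(\sum_{n\ge1}\frac{\tilde a_n(h;p)}{r^n}\Bigr),$$ in the following sense: with $d_0=1$ and $d_m=\frac1m\sum_{k=1}^mk\,\tilde a_k\,d_{m-k}$ for $m\ge1$, for every integer $M\ge0$ there exist constants $C$ and $r_0$ depending only on $M$ and $\mathcal P$ such that for all real $r\ge r_0$ and all $p\in\mathcal P$, $$\Bigl|\;\mathbb E|X-\mu|\Big/\Bigl(\frac1p\sqrt{\frac{2rq}{\pi}}\Bigr)-\sum_{n=0}^{M}\frac{d_n}{r^n}\Bigr|\le C\,r^{-M-1}.$$ Here $\frac1p\sqrt{2rq/\pi}=\sqrt{2\sigma^2/\pi}$. Explicitly, $$\tilde a_1=-\frac1{12}-\frac{p^2}{2q}B_2(h),\qquad \tilde a_2=\frac{p^3(1+q)}{6q^2}B_3(h),\qquad \tilde a_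3=\frac1{360}-\frac{p^4(1+q+q^2)}{12q^3}B_4(h).$$
   Context: $B_k(t)$ and $B_k=B_k(0)$ are the Bernoulli polynomials and numbers: $\frac{z e^{tz}}{e^z-1}=\sum_{k\ge0}B_k(t)\frac{z^k}{k!}$. $\mathrm{NB}(r,p)$ (failures parametrisation, $r>0$ real) has mass function $P(k)=\frac{\Gamma(k+r)}{\Gamma(r)\Gamma(k+1)}p^rq^k$, $k=0,1,2,\dots$. The numbers $d_m$ are the coefficients of the formal re-expansion $\exp(\sum_{k\ge1}\tilde a_kx^{-k})=\sum_{m\ge0}d_mx^{-m}$. *)

(* Defs.v *)
From mathcomp Require Export all_boot all_order all_algebra.
From mathcomp Require Export all_classical all_reals all_analysis.
Export Order.TTheory GRing.Theory Num.Theory.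
Export numFieldNormedType.Exports.

Set Implicit Arguments.
Unset Strict Implicit.
Unset Printing Implicit Defensive.

Local Open Scope classical_set_scope.
Local Open Scope ring_scope.

(* Course-of-values recursion: the sequence u with
   u_n = F [:: u_0; ...; u_(n-1)]. *)
Definition cov_seq (T : Type) (F : seq T -> T) (n : nat) : seq T :=
  iter n (fun s => rcons s (F s)) [::].
Definition cov (T : Type) (F : seq T -> T) (n : nat) : T := F (cov_seq F n).

Lemma cov_seqE (T : Type) (F : seq T -> T) n : cov_seq F n = mkseq (cov F) n.
Proof.
elim: n => [//|n IHn].
by rewrite /mkseq -[in RHS]addn1 iotaD map_cat cats1 /= -/(mkseq _ _) -IHn.
Qed.

Lemma covE (T : Type) (F : seq T -> T) n : cov F n = F (mkseq (cov F) n).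
Proof. by rewrite -cov_seqE. Qed.

(* A formal power series \sum_n a_n z^n is represented by its coefficient
   sequence a.  fps_div a b is the quotient a / b when b_0 is a unit. *)
Definition fps_mul (A : nzRingType) (a b : nat -> A) (n : nat) : A :=
  \sum_(k < n.+1) a k * b (n - k)%N.

Definition fps_div (A : unitRingType) (a b : nat -> A) : nat -> A :=
  cov (fun s : seq A =>
    (a (size s) - \sum_(k < size s) s`_k * b (size s - k)%N) / b 0%N).

Lemma fps_divK (A : unitRingType) (a b : nat -> A) :
  b 0%N \is a GRing.unit -> fps_mul (fps_div a b) b =1 a.
Proof.
move=> ub n; rewrite /fps_mul big_ord_recr /= subnn {2}/fps_div covE size_mkseq.
rewrite divrK // -/(fps_div a b) [X in X + _](_ : _ =
  \sum_(k < n) (mkseq (fps_div a b) n)`_k * b (n - k)%N) ?subrKC ?addrC ?subrK //.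
by apply: eq_bigr => k _; rewrite nth_mkseq.
Qed.

(* The k-th Bernoulli polynomial, from
   \sum_k B_k(t) z^k / k! = e^(tz) / ((e^z - 1) / z), as an identity of formal
   power series in z over R[t] (the variable t is 'X). *)
Definition bernoulli_poly (R : realType) (k : nat) : {poly R} :=
  k`!%:R *: fps_div (fun n => n`!%:R^-1 *: 'X^n)
                    (fun n => (n.+1`!%:R^-1)%:P) k.

Definition bernoulli_number (R : realType) (k : nat) : R :=
  (bernoulli_poly R k).[0].

(* z e^(tz) = (\sum_k B_k(t) z^k / k!) (e^z - 1). *)
Lemma bernoulli_polyP (R : realType) :
  fps_mul (fun k => k`!%:R^-1 *: bernoulli_poly R k)
          (fun n => if n is n'.+1 then (n'.+1`!%:R^-1)%:P else 0) =1
  (fun n => if n is n'.+1 then n'`!%:R^-1 *: 'X^n' else 0).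
Proof.
case=> [|n]; first by rewrite /fps_mul big_ord1 mulr0.
rewrite /fps_mul big_ord_recr /= subnn mulr0 addr0.
have u0 : (1`!%:R^-1)%:P \is a @GRing.unit {poly R}.
  by rewrite (_ : 1`! = 1)%N // invr1 unitr1.
rewrite -(fps_divK (fun n => n`!%:R^-1 *: 'X^n)
                   (b := fun n => (n.+1`!%:R^-1)%:P) u0 n).
apply: eq_bigr => k _; rewrite subSn; last by rewrite -ltnS.
congr (_ * _).
rewrite /bernoulli_poly scalerA mulVf ?scale1r //.
Qed.

Definition Gamma (R : realType) (x : R) : R :=
  \int[@lebesgue_measure R]_(t in `]0, +oo[) (t `^ (x - 1) * expR (- t)).

Definition nb_pmf (R : realType) (r p : R) (k : nat) : R :=
  Gamma (k%:R + r) / (Gamma r * Gamma (k%:R + 1)) * p `^ r * (1 - p) ^+ k.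

Definition nb_distributed (R : realType) (r p : R) (d : measure_display)
    (T : measurableType d) (P : probability T R) (X : {RV P >-> nat}) : Prop :=
  forall k : nat, P (X @^-1` [set k]) = (nb_pmf r p k)%:E.

Definition nb_mean (R : realType) (r p : R) : R := r * (1 - p) / p.

Definition nb_variance (R : realType) (r p : R) : R := r * (1 - p) / p ^+ 2.

Definition nb_shift (R : realType) (r p : R) : R :=
  (Num.ceil (nb_mean r p))%:~R - nb_mean r p.

(* Meaningful for n >= 1 only. *)
Definition atilde (R : realType) (n : nat) (h p : R) : R :=
  let q := 1 - p in
  (- 1) ^+ n.+1 / (n%:R * n.+1%:R) *
  ((p ^+ n - (p / q) ^+ n) * (bernoulli_poly R n.+1).[h]
   - bernoulli_number R n.+1).

(* d_0 = 1 and d_m = m^-1 \sum_(1 <= k <= m) k a_k d_(m-k); see exp_coef0 and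
   exp_coefS. *)
Definition exp_coef (R : realType) (a : nat -> R) : nat -> R :=
  cov (fun s : seq R => let m := size s in
    if m == 0%N then 1
    else m%:R^-1 * \sum_(1 <= k < m.+1) k%:R * a k * s`_(m - k)).

Lemma exp_coef0 (R : realType) (a : nat -> R) : exp_coef a 0 = 1.
Proof. by []. Qed.

Lemma exp_coefS (R : realType) (a : nat -> R) (m : nat) : (0 < m)%N ->
  exp_coef a m =
  m%:R^-1 * \sum_(1 <= k < m.+1) k%:R * a k * exp_coef a (m - k)%N.
Proof.
move=> m0; rewrite {1}/exp_coef covE size_mkseq -/(exp_coef a) gtn_eqF //.
congr (_ * _); apply: eq_big_nat => k /andP[k1 km].
by rewrite nth_mkseq // ltn_subrL k1.
Qed.

(* Main.v *)
(* Telescoping (k - mu) P(k) = T_k - T_(k+1) with T_k = k P(k) / p gives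
   E|X - mu| = 2 T_nu, a quotient of Gamma values at r, r/p + h and rq/p + h.
   Each of them is expanded by Stirling's series with a shift,
     ln Gamma(x + h) ~ ln(2 pi)/2 + \sum_k B_k(h)/k! F^(k)(x),  F(x) = x ln x - x:
   by Taylor's formula and the recurrence of the Bernoulli polynomials, the truncated
   right-hand side satisfies the functional equation of ln Gamma(x + h) up to a
   summable error, and the constant is found from Gamma(1/2) = sqrt(pi).
   In the combination the logarithmic terms cancel and the coefficient of r^-n is
   atilde n h p. *)
Require Import Defs.
From mathcomp Require Import ring lra measurable_realfun.

Set Implicit Arguments.
Unset Strict Implicit.
Unset Printing Implicit Defensive.

Local Open Scope classical_set_scope.
Local Open Scope ring_scope.

(** * The Gamma function *)

(** Since [mu + r = r / p], the arguments [nu = mu + h] and [nu + r] carry the same displacement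
    [h]. The reduction to Gamma values is an exact identity, so the whole asymptotic analysis
    concerns [lnGamma (x + h)]. The functional equation determines [lnGamma] only up to a function
    of period 1. What excludes such an oscillation is one convexity inequality, [GammaD_le]: it
    compares real arguments with neighbouring integers, so the limit constant has to be identified
    along the integers only. The same inequality gives the positivity of [Gamma], without which no
    logarithm could be taken. Uniformity shapes the statements: each constant is fixed from the
    truncation order and a number [e] with [e <= p] and [e <= 1 - p], before [r], [p], [h] appear.
    For this the displacement is treated as a free parameter in [0, 1], untied from [r] and [p]
    until the very end. *)

Lemma measurable_Gamma_integrand (R : realType) (x : R) (A : set R) :
  measurable_fun A (fun t : R => t `^ (x - 1) * expR (- t)).
Proof.
apply: measurable_funTS; apply: measurable_funM; first exact: measurable_powR.
by apply: measurableT_comp => //; exact: measurable_expR.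
Qed.

(** Monotone convergence. The cut-offs stay general because the substitution [t = s^2] in
    [Gamma_half] squares them. *)
Lemma cvg_integral_trunc0y (R : realType) (f : R -> R) (u : nat -> R) :
  measurable_fun setT f -> (forall t, 0 <= f t) ->
  (forall n, (0 < u n)%R) -> {homo u : m n / (m <= n)%N >-> m <= n} ->
  u n @[n --> \oo] --> +oo%R ->
  (\int[@lebesgue_measure R]_(t in `[(u n)^-1%R, u n]) (f t)%:E)%E @[n --> \oo]
    --> (\int[@lebesgue_measure R]_(t in `]0%R, +oo[) (f t)%:E)%E.
Proof.
move=> mf f0 u0 ndu uoo.
have -> : `]0%R, +oo[%classic = \bigcup_n `[(u n)^-1, u n]%classic :> set R.
  apply/seteqP; split => t /=; last first.
    move=> [n _ /=].
    by rewrite !in_itv/= andbT => /andP[+ _]; apply: lt_le_trans; rewrite invr_gt0.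
  rewrite in_itv/= andbT => t0.
  have /cvgryPge/(_ (Num.max t t^-1)) [N _ /(_ N (leqnn N)) /=] := uoo.
  rewrite ge_max => /andP[tu tVu]; exists N => //=.
  by rewrite in_itv/= tu andbT invf_ple// posrE.
apply: ge0_nondecreasing_set_cvg_integral.
- move=> m n mn; apply/subsetPset => t /=; rewrite !in_itv/= => /andP[h1 h2].
  rewrite (le_trans h2 (ndu _ _ mn)) andbT (le_trans _ h1)//.
  by rewrite lef_pV2 ?posrE//; exact: ndu.
- by move=> n; exact: measurable_itv.
- by move=> n; apply: measurable_funTS; apply/measurable_EFinP.
- by move=> n t _; rewrite lee_fin.
Qed.

Lemma powR_leM_expR (R : realType) (c t : R) : 0 < c -> 0 <= t ->
  t `^ c <= c `^ c * expR t.
Proof.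
move=> c0 t0.
have h : t <= c * expR (t / c).
  rewrite -ler_pdivrMl// mulrC (le_trans _ (expR_ge1Dx _))//.
  by rewrite lerDr.
have /(@ge0_ler_powR _ c (ltW c0)) := h.
move=> /(_ _ _)/le_trans; apply.
- by rewrite nnegrE.
- by rewrite nnegrE mulr_ge0 ?expR_ge0// ltW.
by rewrite powRM ?expR_ge0 ?(ltW c0)// -expRM divfK// gt_eqF.
Qed.

Lemma cvgn_powR_expRN (R : realType) (x : R) : 0 < x ->
  (n.+1%:R : R) `^ x * expR (- n.+1%:R) @[n --> \oo] --> 0.
Proof.
move=> x0.
have c0 : 0 < x + 1 by rewrite addr_gt0.
apply: (@squeeze_cvgr _ _ _ _ (fun=> 0) (fun n => (x + 1) `^ (x + 1) * n.+1%:R^-1)).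
- near=> n; apply/andP; split; first by rewrite mulr_ge0 ?powR_ge0 ?expR_ge0.
  have n0 : 0 < n.+1%:R :> R by [].
  rewrite ler_pdivlMr// mulrAC -[X in _ * X * _]powRr1//.
  rewrite -powRD; last by rewrite gt_eqF ?implybT//.
  by rewrite expRN ler_pdivrMr ?expR_gt0//; apply: powR_leM_expR.
- exact: cvg_cst.
- rewrite -[X in _ --> X](mulr0 ((x + 1) `^ (x + 1))).
  by apply: cvgM; [exact: cvg_cst|exact: cvg_harmonic].
Unshelve. all: by end_near. Qed.

Lemma cvgn_powRV_expRN (R : realType) (x : R) : 0 < x ->
  (n.+1%:R^-1 : R) `^ x * expR (- n.+1%:R^-1) @[n --> \oo] --> 0.
Proof.
move=> x0.
have h : (n.+1%:R^-1 : R) `^ x @[n --> \oo] --> 0.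
  apply/cvgrPdist_le => /= e e0.
  have /cvgrPdist_le/(_ (e `^ x^-1)) := @cvg_harmonic R.
  rewrite powR_gt0// => /(_ isT); apply: filterS => n /=.
  rewrite !sub0r !normrN !ger0_norm ?powR_ge0 ?invr_ge0// => hn.
  have := @ge0_ler_powR _ x (ltW x0) _ _ _ _ hn.
  rewrite !nnegrE invr_ge0 ler0n powR_ge0 => /(_ isT isT).
  by rewrite -powRrM mulVf ?gt_eqF// powRr1 // ltW.
apply: (@squeeze_cvgr _ _ _ _ (fun=> 0) (fun n => (n.+1%:R^-1 : R) `^ x)) => //; last exact:
    cvg_cst.
apply: nearW => n; rewrite mulr_ge0 ?powR_ge0 ?expR_ge0//=.
by rewrite ler_piMr ?powR_ge0// -expR0 ler_expR oppr_le0 invr_ge0.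
Qed.

(** [Gamma] is the [fine] of this integral and would read as 0 if it diverged. The functional
    equation is therefore proved here in extended reals, and finiteness is derived from it. *)
Definition eGamma (R : realType) (x : R) : \bar R :=
  (\int[@lebesgue_measure R]_(t in `]0%R, +oo[) (t `^ (x - 1) * expR (- t))%:E)%E.

Lemma eGamma_ge0 (R : realType) (x : R) : (0 <= eGamma x)%E.
Proof.
by apply: integral_ge0 => t _; rewrite lee_fin mulr_ge0 ?powR_ge0 ?expR_ge0.
Qed.

Lemma is_derive_expRN (R : realType) (t : R) :
  is_derive t 1 (fun s : R => - expR (- s)) (expR (- t)).
Proof.
apply: is_derive_eq.
by rewrite mulrN1 opprK.
Qed.

Lemma continuous_expRN (R : realType) : continuous (fun s : R => expR (- s)).
Proof.
move=> t; apply: continuous_comp; first exact: opp_continuous.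
exact: continuous_expR.
Qed.

Lemma powR_is_continuous (R : realType) (a t : R) : 0 < t -> {for t, continuous (fun s : R =>
    s `^ a)}.
Proof.
move=> t0; apply: differentiable_continuous; apply/derivable1_diffP.
by have := is_derive1_powR a t0 => -[].
Qed.

Lemma gauss_half (R : realType) : (\int[@lebesgue_measure R]_(t in `]0%R, +oo[) (gauss_fun
    t)%:E)%E = (Num.sqrt pi / 2)%:E.
Proof.
rewrite -integral0y_gauss integral_itv_obnd_cbnd//.
apply: measurable_funTS; apply/measurable_EFinP; exact: measurable_gauss_fun.
Qed.

Lemma continuous_Gamma_integrand (R : realType) (x a b : R) : 0 < a ->
  {within `[a, b], continuous (fun t : R => t `^ (x - 1) * expR (- t))}.
Proof.
move=> a0; apply: continuous_in_subspaceT => t; rewrite inE/= in_itv/= => /andP[at_ _].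
apply: cvgM; last exact: continuous_expRN.
by apply: powR_is_continuous; exact: lt_le_trans at_.
Qed.

(** Integration by parts away from 0, where the integrand may be singular. Positive [x] yields
    [eGammaD1]; at [x = 0] the last term disappears, which yields [eGamma1]. *)
Lemma Gamma_trunc_rec (R : realType) (x a b : R) : 0 < a -> a < b ->
  (\int[@lebesgue_measure R]_(t in `[a, b]) (t `^ x * expR (- t))%:E =
   (a `^ x * expR (- a) - b `^ x * expR (- b))%:E +
   x%:E * \int[@lebesgue_measure R]_(t in `[a, b]) (t `^ (x - 1) * expR (- t))%:E)%E.
Proof.
move=> a0 ab.
have pos t : t \in `]a, b[ -> 0 < t by rewrite in_itv/= => /andP[+ _]; exact: lt_trans.
rewrite (@integration_by_parts R (fun t => t `^ x) (fun t => - expR (- t))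
  (fun t => x * t `^ (x - 1)) (fun t => expR (- t)) a b ab).
- rewrite (_ : (_ - _)%R = a `^ x * expR (- a) - b `^ x * expR (- b)); last by ring.
  congr (_ + _)%E; rewrite -integralN/=; last first.
    apply: integrable_add_def; first exact: measurable_itv.
    apply: continuous_compact_integrable; first exact: segment_compact.
    apply: continuous_in_subspaceT => t; rewrite inE/= in_itv/= => /andP[at_ _].
    apply: cvgM; first apply: cvgM; first exact: cvg_cst.
      by apply: powR_is_continuous; exact: lt_le_trans at_.
    by apply: cvgN; exact: continuous_expRN.
  rewrite -integralZl//=; last first.
    apply: continuous_compact_integrable; first exact: segment_compact.
    exact: continuous_Gamma_integrand.
  by apply: eq_integral => t _; rewrite -EFinM; congr EFin; ring.
- apply: continuous_in_subspaceT => t; rewrite inE/= in_itv/= => /andP[at_ _].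
  apply: cvgM; first exact: cvg_cst.
  by apply: powR_is_continuous; exact: lt_le_trans at_.
- split.
  + by move=> t /pos t0; have := is_derive1_powR x t0 => -[].
  + by apply: cvg_at_right_filter; exact: powR_is_continuous.
  + by apply: cvg_at_left_filter; apply: powR_is_continuous; exact: lt_trans ab.
- by move=> t /pos t0; rewrite derive1E; have := is_derive1_powR x t0 => -[].
- by apply: continuous_subspaceT; exact: continuous_expRN.
- split.
  + by move=> t _; have := is_derive_expRN t => -[].
  + by apply: cvg_at_right_filter; apply: cvgN; exact: continuous_expRN.
  + by apply: cvg_at_left_filter; apply: cvgN; exact: continuous_expRN.
- by move=> t _; rewrite derive1E; have := is_derive_expRN t => -[].
Qed.

Lemma homo_natS (R : realType) : {homo (fun n => n.+1%:R : R) : m n / (m <= n)%N >-> m <= n}.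
Proof. by move=> m n mn; rewrite ler_nat. Qed.

Lemma cvg_natS (R : realType) : (n.+1%:R : R) @[n --> \oo] --> +oo.
Proof. by rewrite (cvg_shiftS (fun n => n%:R : R)); exact: cvgr_idn. Qed.

Lemma cvg_Gamma_trunc (R : realType) (x : R) :
  (\int[@lebesgue_measure R]_(t in `[n.+1%:R^-1%R, n.+1%:R]) (t `^ (x - 1) * expR (- t))%:E)%E
    @[n --> \oo] --> eGamma x.
Proof.
apply: (@cvg_integral_trunc0y R (fun t => t `^ (x - 1) * expR (- t)) (fun n => n.+1%:R)).
- exact: measurable_Gamma_integrand.
- by move=> t; rewrite mulr_ge0 ?powR_ge0 ?expR_ge0.
- by [].
- exact: homo_natS.
- exact: cvg_natS.
Qed.

Lemma eGammaD1 (R : realType) (x : R) : 0 < x -> eGamma (x + 1) = (x%:E * eGamma x)%E.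
Proof.
move=> x0; have h := @cvg_Gamma_trunc R (x + 1).
apply: (cvg_unique _ h) => //.
pose B n : R := n.+1%:R^-1 `^ x * expR (- n.+1%:R^-1) - n.+1%:R `^ x * expR (- n.+1%:R).
apply: (@cvg_trans _ ((B n)%:E + x%:E * \int[@lebesgue_measure R]_(t in `[n.+1%:R^-1%R,
    n.+1%:R]) (t `^ (x - 1) * expR (- t))%:E @[n --> \oo])%E).
  apply: near_eq_cvg; near=> n.
  rewrite addrK -Gamma_trunc_rec ?invr_gt0//.
  have n0 : (0 < n)%N by near: n; exact: nbhs_infty_gt.
  by apply: (@lt_trans _ _ 1); rewrite ?invf_lt1 ?ltr1n.
rewrite -[(x%:E * eGamma x)%E]add0e; apply: cvgeD.
- by rewrite fin_num_adde_defr.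
- apply: cvg_EFin; first by near=> n.
  rewrite -[X in _ --> X](subrr 0); apply: cvgB; first exact: cvgn_powRV_expRN.
  exact: cvgn_powR_expRN.
- by apply: cvgeZl => //; exact: cvg_Gamma_trunc.
Unshelve. all: by end_near. Qed.

Lemma eGamma1 (R : realType) : eGamma (1 : R) = 1%E.
Proof.
have h := @cvg_Gamma_trunc R 1.
apply: (cvg_unique _ h) => //.
pose B n : R := expR (- n.+1%:R^-1) - expR (- n.+1%:R).
apply: (@cvg_trans _ ((B n)%:E @[n --> \oo])).
  apply: near_eq_cvg; near=> n.
  have n0 : (0 < n)%N by near: n; exact: nbhs_infty_gt.
  rewrite subrr; have := @Gamma_trunc_rec R 0 n.+1%:R^-1 n.+1%:R.
  rewrite mul0e adde0 !powRr0 !mul1r => -> //.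
  by apply: (@lt_trans _ _ 1); rewrite ?invf_lt1 ?ltr1n.
apply: cvg_EFin; first by near=> n.
rewrite -[X in _ --> X]subr0; apply: cvgB.
  rewrite -[X in _ --> X]expR0 -[X in expR X]oppr0.
  by apply: (@cvg_comp _ _ _ (fun n => n.+1%:R^-1) (fun s : R => expR (- s)) _ _ _
      (@cvg_harmonic R)); exact: continuous_expRN.
by rewrite (cvg_shiftS (fun n => expR (- n%:R) : R)); exact: cvgn_expR.
Unshelve. all: by end_near. Qed.

Lemma eGamma_nat (R : realType) n : eGamma (n.+1%:R : R) = (n`!%:R)%:E.
Proof.
elim: n => [|n ih]; first by rewrite eGamma1.
by rewrite -addn1 natrD eGammaD1// ih -EFinM -natrM -factS.
Qed.

Lemma measurable_EFin_Gamma_integrand (R : realType) (x : R) (A : set R) :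
  measurable_fun A (fun t : R => (t `^ (x - 1) * expR (- t))%:E).
Proof. by apply/measurable_EFinP; exact: measurable_Gamma_integrand. Qed.

(** Passing to [x + 1] makes the exponent positive, so the power of [t] is at most 1 on ]0, 1] and
    at most an integer power beyond. This bounds [eGamma (x + 1)] by two factorials, and the
    functional equation brings the bound back to [x]. *)
Lemma eGamma_lty (R : realType) (x : R) : 0 < x -> (eGamma x < +oo)%E.
Proof.
move=> x0.
suff : (eGamma (x + 1) < +oo)%E.
  rewrite eGammaD1//; have := eGamma_ge0 x; case: (eGamma x) => [r _ _|_|].
  - by rewrite ltry.
  - by rewrite gt0_muley// lte_fin.
  - by [].
set m := Num.trunc x.
have xm : x < m.+1%:R by apply: Num.Theory.truncnS_gt; rewrite ltW.
apply: (@le_lt_trans _ _ (eGamma 1 + eGamma m.+2%:R)%E); last first.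
  by rewrite eGamma1 eGamma_nat -EFinD ltry.
rewrite /eGamma -ge0_integralD//=; last 4 first.
- by move=> t _; rewrite lee_fin mulr_ge0 ?powR_ge0 ?expR_ge0.
- exact: measurable_EFin_Gamma_integrand.
- by move=> t _; rewrite lee_fin mulr_ge0 ?powR_ge0 ?expR_ge0.
- exact: measurable_EFin_Gamma_integrand.
apply: ge0_le_integral => //.
- by move=> t _; rewrite lee_fin mulr_ge0 ?powR_ge0 ?expR_ge0.
- exact: measurable_EFin_Gamma_integrand.
- by apply: emeasurable_funD; exact: measurable_EFin_Gamma_integrand.
move=> t; rewrite /= in_itv/= andbT => t0.
rewrite -EFinD lee_fin -mulrDl ler_wpM2r ?expR_ge0// addrK subrr powRr0.
rewrite (_ : m.+2%:R - 1 = m.+1%:R); last by rewrite -natr1 addrK.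
have [t1|t1] := leP t 1.
  rewrite (@le_trans _ _ 1)// ?lerDl ?powR_ge0//.
  by have := @ge0_ler_powR _ x (ltW x0) t 1; rewrite !nnegrE powR1; apply => //; exact: ltW.
by rewrite (@le_trans _ _ (t `^ m.+1%:R))// ?lerDr// ler_powR// ltW.
Qed.

Lemma GammaE (R : realType) (x : R) : 0 < x -> (Gamma x)%:E = eGamma x.
Proof.
move=> x0; rewrite /Gamma /Rintegral fineK//.
by rewrite ge0_fin_numE ?eGamma_ge0// eGamma_lty.
Qed.

Lemma Gamma_ge0 (R : realType) (x : R) : 0 <= Gamma x.
Proof. by rewrite fine_ge0//; exact: eGamma_ge0. Qed.

Lemma GammaD1 (R : realType) (x : R) : 0 < x -> Gamma (x + 1) = x * Gamma x.
Proof.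
move=> x0; apply: EFin_inj; rewrite GammaE ?addr_gt0// eGammaD1// EFinM.
by rewrite GammaE.
Qed.

Lemma Gamma_nat (R : realType) n : Gamma (n.+1%:R : R) = n`!%:R.
Proof. by apply: EFin_inj; rewrite GammaE// eGamma_nat. Qed.

(** Concavity: the right-hand side is the tangent at [y]. For [0 < s < 1] this is Young's inequality
    with exponents [s^-1] and [(1 - s)^-1], which degenerate at the two ends. *)
Lemma powR_le_tangent (R : realType) (s t y : R) : 0 <= s <= 1 -> 0 <= t -> 0 < y ->
  t `^ s <= y `^ s * ((1 - s) + s * (t / y)).
Proof.
move=> /andP[s0 s1] t0 y0.
have key u : 0 <= u -> u `^ s <= (1 - s) + s * u.
  move=> u0; have [->|sn0] := eqVneq s 0; first by rewrite powRr0 subr0 mul0r addr0.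
  have [->|sn1] := eqVneq s 1; first by rewrite powRr1// subrr add0r mul1r.
  have s0' : 0 < s by rewrite lt_neqAle eq_sym sn0.
  have s1' : 0 < 1 - s by rewrite subr_gt0 lt_neqAle sn1.
  have := @conjugate_powR _ (u `^ s) 1 s^-1 (1 - s)^-1.
  rewrite powR_ge0 ler01 !invr_gt0 s0' s1' !invrK subrKC.
  move=> /(_ isT isT isT isT erefl).
  by rewrite mulr1 -powRrM divff// powRr1// powR1 mul1r mulrC addrC.
have := key (t / y); rewrite divr_ge0 ?(ltW y0)// => /(_ isT).
move=> /(ler_wpM2l (powR_ge0 y s)); apply: le_trans.
by rewrite -powRM ?divr_ge0 ?(ltW y0)// mulrC divfK ?gt_eqF.
Qed.

(** Jensen's inequality for the Gamma density of parameter [x]. Its mean is [x], so the tangent is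
    taken at [x] and its linear part integrates to 1. *)
Lemma GammaD_le (R : realType) (x s : R) : 0 < x -> 0 <= s <= 1 ->
  Gamma (x + s) <= x `^ s * Gamma x.
Proof.
move=> x0 s01; have /andP[s0 s1] := s01.
have y0 : 0 < x `^ s by rewrite powR_gt0.
have c1 : 0 <= x `^ s * (1 - s) by rewrite mulr_ge0 ?powR_ge0 ?subr_ge0.
have c2 : 0 <= x `^ s * (s / x) by rewrite mulr_ge0 ?powR_ge0 ?divr_ge0 ?(ltW x0).
suff h : (eGamma (x + s) <= (x `^ s * (1 - s))%:E * eGamma x + (x `^ s * (s / x))%:E * eGamma
    (x + 1))%E.
  rewrite -lee_fin GammaE ?ltr_wpDr//; apply: le_trans h _.
  rewrite -!GammaE ?addr_gt0// -!EFinM -EFinD lee_fin GammaD1//.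
  by rewrite le_eqVlt; apply/orP; left; apply/eqP; field; rewrite gt_eqF.
rewrite /eGamma -!ge0_integralZl_EFin//=; first last.
- exact: measurable_EFin_Gamma_integrand.
- by move=> t _; rewrite lee_fin mulr_ge0 ?powR_ge0 ?expR_ge0.
- exact: measurable_EFin_Gamma_integrand.
- by move=> t _; rewrite lee_fin mulr_ge0 ?powR_ge0 ?expR_ge0.
rewrite -ge0_integralD//=; last 4 first.
- by move=> t _; rewrite lee_fin !mulr_ge0 ?powR_ge0 ?expR_ge0// subr_ge0.
- by apply: measurable_funeM; exact: measurable_EFin_Gamma_integrand.
- by move=> t _; rewrite lee_fin !mulr_ge0 ?powR_ge0 ?expR_ge0// ?invr_ge0 ltW.
- by apply: measurable_funeM; exact: measurable_EFin_Gamma_integrand.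
apply: ge0_le_integral => //.
- by move=> t _; rewrite lee_fin mulr_ge0 ?powR_ge0 ?expR_ge0.
- exact: measurable_EFin_Gamma_integrand.
- by apply: emeasurable_funD; apply: measurable_funeM; exact: measurable_EFin_Gamma_integrand.
move=> t; rewrite /= in_itv/= andbT => t0.
rewrite lee_fin !mulrA -mulrDl ler_wpM2r ?expR_ge0//.
rewrite addrK.
have -> : t `^ (x + s - 1) = t `^ (x - 1) * t `^ s.
  by rewrite -powRD ?(gt_eqF t0) ?implybT// addrAC.
have -> : t `^ x = t `^ (x - 1) * t.
  by rewrite -[X in _ * X](powRr1 (ltW t0)) -powRD ?subrK// (gt_eqF t0) implybT.
have := powR_le_tangent s01 (ltW t0) x0.
move=> /(ler_wpM2l (powR_ge0 t (x - 1))) /le_trans; apply.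
by rewrite le_eqVlt; apply/orP; left; apply/eqP; ring.
Qed.

(** If [Gamma x] were 0, [GammaD_le] would make [Gamma] vanish at the next integer, where it is a
    factorial. *)
Lemma Gamma_gt0 (R : realType) (x : R) : 0 < x -> 0 < Gamma x.
Proof.
move=> x0; rewrite lt_neqAle Gamma_ge0 andbT eq_sym; apply/eqP => G0.
set m := Num.trunc x.
have mx : m%:R <= x by rewrite Num.Theory.truncn_le ltW.
have xm : x < m.+1%:R by apply: Num.Theory.truncnS_gt; rewrite ltW.
have := @GammaD_le R x (m.+1%:R - x) x0.
rewrite subr_ge0 (ltW xm) lerBlDr -nat1r lerD2l mx => /(_ isT).
rewrite nat1r subrKC G0 mulr0 Gamma_nat => /le_lt_trans - /(_ m`!%:R).
by rewrite ltr0n fact_gt0 ltxx => /(_ isT).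
Qed.

(** With [t = s^2] the factor [2 s] absorbs the inverse square root of [t], leaving twice the
    half-line Gaussian integral. The substitution is made on truncations. *)
Lemma Gamma_half (R : realType) : Gamma (2^-1 : R) = Num.sqrt pi.
Proof.
apply: EFin_inj; rewrite GammaE ?invr_gt0//.
pose u n : R := n.+1%:R ^+ 2.
have u0 n : 0 < u n by rewrite exprn_gt0.
have ndu : {homo u : m n / (m <= n)%N >-> m <= n}.
  by move=> m n mn; rewrite lerXn2r ?nnegrE// ler_nat.
have uoo : u n @[n --> \oo] --> +oo.
  apply: ger_cvgy (@cvg_natS R).
  by apply: nearW => n; rewrite /u expr2 ler_peMr// ler1n.
have h1 := cvg_integral_trunc0y (@measurable_Gamma_integrand R 2^-1 setT)
  (fun t => mulr_ge0 (powR_ge0 _ _) (expR_ge0 _)) u0 ndu uoo.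
apply: (cvg_unique _ h1) => //.
have h2 := cvg_integral_trunc0y (@measurable_gauss_fun R) (@gauss_fun_ge0 R)
  (fun n => ltr0Sn R n) (@homo_natS R) (@cvg_natS R).
rewrite gauss_half in h2.
have -> : (Num.sqrt pi)%:E = (2%:E * (Num.sqrt pi / 2)%:E)%E :> \bar R.
  by rewrite -EFinM mulrC divfK.
apply: cvg_trans (cvgeZl _ h2) => //.
apply: near_eq_cvg; near=> n.
rewrite -ge0_integralZl_EFin//=; last 2 first.
- by move=> t _; rewrite lee_fin gauss_fun_ge0.
- by apply: measurable_funTS; apply/measurable_EFinP; exact: measurable_gauss_fun.
have dF (t : R) : is_derive t 1 (fun s : R => s ^+ 2) (2 * t).
  by apply: is_derive_eq; rewrite /GRing.scale/= ; ring.
have dF1 (t : R) : (fun s : R => s ^+ 2)^`()%classic t = 2 * t.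
  by rewrite derive1E; have := dF t => -[].
have cF (t : R) : {for t, continuous (fun s : R => s ^+ 2)}.
  by apply: differentiable_continuous; apply/derivable1_diffP; have := dF t => -[].
have cdF (t : R) : {for t, continuous (fun s : R => s ^+ 2)^`()%classic}.
  rewrite (_ : _^`()%classic = fun t => 2 * t); last exact/funext.
  by apply: cvgM; [exact: cvg_cst|exact: cvg_id].
have := @integration_by_substitution_increasing R (fun s => s ^+ 2)
  (fun t => t `^ (2^-1 - 1) * expR (- t)) n.+1%:R^-1 n.+1%:R.
rewrite exprVn => ->.
- apply: eq_integral => t; rewrite inE/= in_itv/= => /andP[t1 _].
  have t0 : 0 < t by apply: lt_le_trans t1; rewrite invr_gt0.
  rewrite -EFinM; congr EFin.
  rewrite -[RHS]/((t ^+ 2) `^ (2^-1 - 1) * expR (- (t ^+ 2)) * (fun s : R => s ^+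
      2)^`()%classic t).
  rewrite dF1 /gauss_fun -powR_mulrn ?(ltW t0)// -powRrM.
  rewrite (_ : 2%:R * (2^-1 - 1) = - 1 :> R); last by field.
  by rewrite powR_inv1 ?(ltW t0)//; field; rewrite gt_eqF.
- by rewrite (@le_trans _ _ 1)// ?invf_le1 ?ler1n.
- move=> s t; rewrite !in_itv/= => /andP[s1 _] /andP[t1 _] st.
  have s0 : 0 < s by apply: lt_le_trans s1; rewrite invr_gt0.
  by rewrite ltrXn2r// ?nnegrE ltW//; exact: lt_trans st.
- by move=> t _; exact: cdF.
- by apply/cvg_ex; eexists; apply: cvg_at_right_filter; exact: cdF.
- by apply/cvg_ex; eexists; apply: cvg_at_left_filter; exact: cdF.
- split.
  + by move=> t _; have := dF t => -[].
  + by apply: cvg_at_right_filter; exact: cF.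
  + by apply: cvg_at_left_filter; exact: cF.
- by rewrite -exprVn; apply: continuous_Gamma_integrand; rewrite exprn_gt0 ?invr_gt0.
Unshelve. all: by end_near. Qed.

(** * Stirling's expansion with a shift *)

Lemma derive_bound (R : realType) (g dg : R -> R) (t C : R) : 0 <= t ->
  (forall s : R, 0 <= s <= t -> is_derive s 1 g (dg s)) ->
  (forall s : R, 0 <= s <= t -> `|dg s| <= C) ->
  `|g t - g 0| <= C * t.
Proof.
move=> t0 dgE dgC.
have [s||c] := @MVT_segment R g dg 0 t t0.
- by rewrite in_itv/= => /andP[s0 st]; apply: dgE; rewrite !ltW.
- apply: derivable_within_continuous => s; rewrite in_itv/= => st.
  by have := dgE _ st => -[].
rewrite in_itv/= => ct ->; rewrite subr0 normrM (ger0_norm t0).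
by rewrite ler_wpM2r// dgC.
Qed.

(* The remainder bound is deliberately crude: [t <= 1] absorbs the powers of [t]
   and the factorial. *)
Lemma taylor_bound (R : realType) (n : nat) (f : nat -> R -> R) (x C : R) :
  (forall k y, x <= y <= x + 1 -> is_derive y 1 (f k) (f k.+1 y)) ->
  (forall y, x <= y <= x + 1 -> `|f n y| <= C) ->
  forall t : R, 0 <= t <= 1 ->
  `|f 0%N (x + t) - \sum_(j < n) f j x / j`!%:R * t ^+ j| <= C.
Proof.
elim: n f => [|n ih] f df fC t /andP[t0 t1].
  by rewrite big_ord0 subr0; apply: fC; rewrite lerDl t0 lerD2l.
have C0 : 0 <= C by apply: (le_trans (normr_ge0 _) (fC x _)); rewrite lexx lerDl ler01.
pose p := \poly_(j < n.+1) (f j x / j`!%:R).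
pose g s := f 0%N (x + s) - p.[s].
pose dg s := f 1%N (x + s) - p^`().[s].
have dgE s : 0 <= s <= t -> is_derive s 1 g (dg s).
  move=> /andP[s0 st]; apply: is_deriveB.
  rewrite -[X in is_derive _ _ _ X]mulr1.
  apply: (@is_derive1_comp R (f 0%N) (fun s => x + s)).
    by apply: df; rewrite lerDl s0 lerD2l (le_trans st).
  rewrite -[X in is_derive _ _ _ X]add0r.
  by apply: is_deriveD.
have p'E s : p^`().[s] = \sum_(j < n) f j.+1 x / j`!%:R * s ^+ j.
  rewrite (_ : p^`() = \poly_(j < n) (f j.+1 x / j`!%:R)) ?horner_poly//.
  apply/polyP => i; rewrite coef_deriv !coef_poly ltnS.
  case: ltnP => // _; last by rewrite mul0rn.
  rewrite -[LHS]mulr_natr factS natrM invfM [X in _ * X * _]mulrC mulrA.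
  by rewrite divfK// pnatr_eq0.
have gt : f 0%N (x + t) - \sum_(j < n.+1) f j x / j`!%:R * t ^+ j = g t - g 0.
  by rewrite /g addr0 horner_coef0 coef_poly/= fact0 divr1 subrr subr0 horner_poly.
rewrite gt; apply: (@le_trans _ _ (C * t)); last by rewrite ler_piMr.
apply: derive_bound dgE _ => // s /andP[s0 st].
have s01 : 0 <= s <= 1 by rewrite s0 (le_trans st).
rewrite /dg p'E; exact: (ih (fun k => f k.+1) (fun k => df k.+1) fC s s01).
Qed.

Definition xlnx_deriv (R : realType) (k : nat) (x : R) : R :=
  match k with
  | 0%N => x * ln x - x
  | 1%N => ln x
  | j.+2 => (- 1) ^+ j * j`!%:R * x^-1 ^+ j.+1
  end.

Lemma is_derive_xlnx (R : realType) (k : nat) (x : R) : 0 < x ->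
  is_derive x 1 (xlnx_deriv k : R -> R) (xlnx_deriv k.+1 x).
Proof.
move=> x0; have xn0 : x != 0 by rewrite gt_eqF.
case: k => [|[|k]] /=.
- have := is_derive1_ln x0 => ?.
  apply: is_derive_eq; rewrite /GRing.scale/=; field.
  by [].
- have := is_derive1_ln x0; rewrite fact0 expr0 expr1 !mul1r; exact.
- have h : is_derive x 1 (fun y : R => y^-1) (- x ^- 2 *: 1).
    by apply: is_deriveV.
  have h2 := @is_deriveX _ _ _ k.+1 _ _ _ h.
  have h3 := is_deriveZ ((- 1) ^+ k * k`!%:R) h2.
  rewrite (_ : xlnx_deriv k.+2 = ((- 1) ^+ k * k`!%:R) \*: ((fun y : R => y^-1) ^+ k.+1));
      last first.
    by apply/funext => y /=; rewrite /GRing.scale/= fctE.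
  apply: is_derive_eq h3 _.
  rewrite /GRing.scale/= factS natrM !exprS; field.
  by [].
Qed.

Definition bernoulli_egf (R : realType) (h : R) (k : nat) : R :=
  k`!%:R^-1 * (bernoulli_poly R k).[h].

(** [N] counts the inverse powers of [x]: the indices 0 and 1 give the logarithmic terms, and [j.+2]
    gives the power [j.+1] of [x^-1]. *)
Definition stirling_shift (R : realType) (N : nat) (h x : R) : R :=
  \sum_(k < N.+2) bernoulli_egf h k * xlnx_deriv k x.

Lemma bernoulli_egf_rec (R : realType) (h : R) (m : nat) :
  \sum_(k < m.+1) bernoulli_egf h k * (m.+1 - k)`!%:R^-1 = m`!%:R^-1 * h ^+ m.
Proof.
have := @bernoulli_polyP R m.+1.
rewrite /fps_mul big_ord_recr/= subnn mulr0 addr0 => /(congr1 (fun p => p.[h])).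
rewrite horner_sum hornerZ hornerXn => <-.
apply: eq_bigr => k _; rewrite subSn; last by rewrite -ltnS.
by rewrite hornerM hornerZ hornerC.
Qed.

Lemma bernoulli_egf0 (R : realType) (h : R) : bernoulli_egf h 0 = 1.
Proof.
by have := bernoulli_egf_rec h 0; rewrite big_ord1 fact0 expr0 !invr1 !mulr1.
Qed.

Lemma bernoulli_egf1 (R : realType) (h : R) : bernoulli_egf h 1 = h - 2^-1.
Proof.
have := bernoulli_egf_rec h 1; rewrite big_ord_recr big_ord1/= bernoulli_egf0.
rewrite (_ : 2`! = 2)%N// (_ : 1`! = 1)%N// expr1 => e.
by lra.
Qed.

Lemma horner_bounded01 (R : realType) (p : {poly R}) :
  exists2 A : R, 0 <= A & forall h : R, 0 <= h <= 1 -> `|p.[h]| <= A.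
Proof.
exists (\sum_(i < size p) `|p`_i|); first exact: sumr_ge0.
move=> h /andP[h0 h1]; rewrite horner_coef.
apply: le_trans (ler_norm_sum _ _ _) _; apply: ler_sum => i _.
rewrite normrM ler_piMr// normrX (ger0_norm h0).
by rewrite exprn_ile1.
Qed.

Lemma bernoulli_egf_bounded (R : realType) (n : nat) :
  exists2 A : R, 0 <= A & forall (h : R) k, 0 <= h <= 1 -> (k < n)%N -> `|bernoulli_egf h k|
      <= A.
Proof.
elim: n => [|n [A A0 ih]]; first by exists 0.
have [B B0 hB] := horner_bounded01 (n`!%:R^-1 *: bernoulli_poly R n).
exists (A + B); first exact: addr_ge0.
move=> h k h01; rewrite ltnS leq_eqVlt => /predU1P[->|kn].
  by rewrite /bernoulli_egf -hornerZ (le_trans (hB _ h01))// lerDr.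
by rewrite (le_trans (ih _ _ h01 kn))// lerDl.
Qed.

(** Coefficients of [e^z - 1]. The value 0 at index 0 also kills the terms where the truncated
    subtraction [m - k] is 0, so triangular sums can run over full ranges. *)
Definition expm1_coef (R : realType) (i : nat) : R :=
  if i is i'.+1 then (i'.+1)`!%:R^-1 else 0.

(** The [k]-th derivative is expanded to order [n - k], so that every remainder involves the same
    function [f n]. *)
Lemma taylor_diff_bound (R : realType) (n k : nat) (f : nat -> R -> R) (x C : R) :
  (forall k y, x <= y <= x + 1 -> is_derive y 1 (f k) (f k.+1 y)) ->
  (forall y, x <= y <= x + 1 -> `|f n y| <= C) -> (k < n)%N ->
  `|f k (x + 1) - f k x - \sum_(m < n) expm1_coef R (m - k) * f m x| <= C.
Proof.
move=> df fC kn; have := @taylor_bound R (n - k) (fun j => f (j + k)%N) x C.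
rewrite subnK ?(ltnW kn)// => /(_ (fun j y => df (j + k)%N y) fC 1).
rewrite ler01 lexx => /(_ isT); apply: le_trans.
rewrite le_eqVlt; apply/orP; left; apply/eqP; congr `|_|.
rewrite add0n -addrA -opprD; congr (_ - _).
rewrite -[in RHS](subnSK kn) [RHS]big_ord_recl/= add0n fact0 expr0 divr1 mulr1.
congr (_ + _).
rewrite -(big_mkord xpredT (fun m => expm1_coef R (m - k) * f m x)).
rewrite (@big_cat_nat _ _ _ k.+1)//= big_nat big1 ?add0r; last first.
  by move=> i; rewrite ltnS -subn_eq0 => /andP[_ /eqP ->]; rewrite mul0r.
rewrite -[k.+1]add0n big_addn big_mkord; apply: eq_bigr => i _.
by rewrite expr1n mulr1 addnS subSn ?leq_addl// addnK mulrC.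
Qed.

Lemma sum_bernoulli_expm1 (R : realType) (h : R) (n m : nat) : (m < n)%N ->
  \sum_(k < n) bernoulli_egf h k * expm1_coef R (m - k) =
  if m is m'.+1 then m'`!%:R^-1 * h ^+ m' else 0.
Proof.
move=> mn; rewrite (bigID (fun k : 'I_n => k < m)%N)/= [X in _ + X]big1 ?addr0; last first.
  by move=> k; rewrite -leqNgt -subn_eq0 => /eqP ->; rewrite mulr0.
rewrite -(big_ord_widen n (fun k => bernoulli_egf h k * expm1_coef R (m - k)) (ltnW mn)).
case: m mn => [|m] mn; first by rewrite big_ord0.
rewrite -bernoulli_egf_rec; apply: eq_bigr => k _.
by rewrite /expm1_coef subSn// -ltnS.
Qed.

(** With [D] for differentiation, the generating identity reads
    [(\sum_k b_k D^k) (e^D - 1) = D e^(hD)]; applied to [F = x ln x - x] it gives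
    [F'(x + h) = ln (x + h)]. All Taylor remainders, those of the [N.+2] differences and that of
    [ln (x + h)], are controlled by the derivative of order [N.+2], whence the constant. *)
Lemma stirling_shift_diff (R : realType) (N : nat) : exists2 K : R, 0 <= K &
  forall h x : R, 0 <= h <= 1 -> 0 < x ->
  `|stirling_shift N h (x + 1) - stirling_shift N h x - ln (x + h)| <= K * x^-1 ^+ N.+1.
Proof.
have [A A0 hA] := bernoulli_egf_bounded R N.+2.
exists ((\sum_(k < N.+2) A + 1) * N`!%:R).
  by rewrite mulr_ge0// addr_ge0// sumr_ge0.
move=> h x h01 x0.
pose C : R := N`!%:R * x^-1 ^+ N.+1.
have dF k y : x <= y <= x + 1 -> is_derive y 1 (xlnx_deriv k : R -> R) (xlnx_deriv k.+1 y).
  by move=> /andP[xy _]; apply: is_derive_xlnx; exact: lt_le_trans xy.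
have FC y : x <= y <= x + 1 -> `|xlnx_deriv N.+2 y| <= C.
  move=> /andP[xy _]; rewrite /= !normrM normrX normrN1 expr1n mul1r normr_nat.
  rewrite ler_wpM2l// normrX lerXn2r ?nnegrE ?invr_ge0 ?(ltW x0)//.
  rewrite ger0_norm ?invr_ge0 ?(le_trans (ltW x0))//.
  by rewrite lef_pV2 ?posrE//; exact: lt_le_trans xy.
have eC (k : 'I_N.+2) := taylor_diff_bound dF FC (ltn_ord k).
have e1 := @taylor_bound R N.+1 (fun k => xlnx_deriv k.+1) x C (fun k => dF k.+1) FC h h01.
have -> : stirling_shift N h (x + 1) - stirling_shift N h x - ln (x + h) =
  \sum_(k < N.+2) bernoulli_egf h k * (xlnx_deriv k (x + 1) - xlnx_deriv k x -
     \sum_(m < N.+2) expm1_coef R (m - k) * xlnx_deriv m x)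
  - (xlnx_deriv 1 (x + h) - \sum_(j < N.+1) xlnx_deriv j.+1 x / j`!%:R * h ^+ j).
  rewrite (eq_bigr (fun k : 'I_N.+2 => (bernoulli_egf h k * xlnx_deriv k (x + 1) -
    bernoulli_egf h k * xlnx_deriv k x) -
     \sum_(m < N.+2) bernoulli_egf h k * expm1_coef R (m - k) * xlnx_deriv m x)); last first.
    move=> k _; rewrite !mulrBr mulr_sumr; congr (_ - _).
    by apply: eq_bigr => m _; rewrite mulrA.
  have -> : \sum_(j < N.+1) xlnx_deriv j.+1 x / j`!%:R * h ^+ j =
      \sum_(k < N.+2) \sum_(m < N.+2) bernoulli_egf h k * expm1_coef R (m - k) * xlnx_deriv m x.
    rewrite exchange_big [RHS]big_ord_recl [X in _ = X + _]big1 ?add0r; last first.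
      by move=> k _; rewrite /= mulr0 mul0r.
    apply: eq_bigr => m _.
    rewrite -mulr_suml (sum_bernoulli_expm1 h (ltn_ord (lift ord0 m))) lift0 /=.
    by rewrite [RHS]mulrC mulrA.
  by rewrite sumrB sumrB /stirling_shift/= opprB addrA subrK.
apply: le_trans (ler_normB _ _) _; rewrite -mulrA mulrDl mul1r lerD//.
apply: le_trans (ler_norm_sum _ _ _) _; rewrite mulr_suml; apply: ler_sum => k _.
by rewrite normrM ler_pM// hA.
Qed.

(** For [y >= 1], [y^-2 <= 2 / (y (y + 1)) = 2 (y^-1 - (y + 1)^-1)], and the other [N] powers are
    frozen at [x]. Keeping the difference of inverses in the bound makes the induction close. *)
Lemma telescope_bound (R : realType) (E : R -> R) (K : R) (N : nat) (x : R) : 0 <= K -> 1 <=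
    x ->
  (forall y, x <= y -> `|E (y + 1) - E y| <= K * y^-1 ^+ N.+2) ->
  forall m, `|E (x + m%:R) - E x| <= 2 * K * x^-1 ^+ N * (x^-1 - (x + m%:R)^-1).
Proof.
move=> K0 x1 hE; have x0 : 0 < x by apply: lt_le_trans x1.
elim=> [|m ih]; first by rewrite addr0 !subrr normr0 mulr0.
set y := x + m%:R.
have xy : x <= y by rewrite lerDl.
have y1 : 1 <= y by exact: le_trans xy.
have y0 : 0 < y by exact: lt_le_trans xy.
have -> : x + m.+1%:R = y + 1 by rewrite /y -natr1 addrA.
rewrite (_ : E (y + 1) - E x = (E (y + 1) - E y) + (E y - E x)); last by ring.
apply: le_trans (ler_normD _ _) _.
rewrite (_ : _ * (_ - _) = 2 * K * x^-1 ^+ N * (y^-1 - (y + 1)^-1) + 2 * K * x^-1 ^+ N *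
    (x^-1 - y^-1)); last by ring.
rewrite lerD//; apply: le_trans (hE _ xy) _.
rewrite -addn2 exprD mulrA [2 * K]mulrC -!mulrA ler_wpM2l//.
rewrite [X in _ <= X]mulrCA ler_pM ?exprn_ge0 ?invr_ge0 ?(ltW y0)//.
  by rewrite lerXn2r ?nnegrE ?invr_ge0 ?(ltW x0) ?(ltW y0)// lef_pV2.
rewrite (_ : _ * (_ - _) = 2 / (y * (y + 1))); last first.
  by field; rewrite !gt_eqF// addr_gt0.
rewrite exprVn expr2 -[X in X <= _]div1r ler_pdivrMr ?mulr_gt0//.
rewrite (_ : _ / _ * _ = 2 * y / (y + 1)); last by field; rewrite !gt_eqF// addr_gt0.
have h2 : y + 1 <= 2 * y by rewrite mulr_natl mulr2n lerD2l.
have h3 : 0 < y + 1 by rewrite addr_gt0.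
by rewrite (ler_pdivlMr _ _ h3) mul1r.
Qed.

(** * Stirling's constant and the expansion of [lnGamma] *)

Lemma ln1D_bounds (R : realType) (u : R) : 0 <= u -> u / (1 + u) <= ln (1 + u) <= u.
Proof.
move=> u0; have u1 : 0 < 1 + u by rewrite ltr_wpDr.
apply/andP; split; last by apply: le_ln1Dx; rewrite (lt_le_trans _ u0).
have := @le_ln1Dx R (- (u / (1 + u))).
rewrite (_ : 1 - u / (1 + u) = (1 + u)^-1); last by field; rewrite gt_eqF.
rewrite lnV ?posrE// ltrN2 ltr_pdivrMr// mul1r ltrDr ltr01 => /(_ isT).
by rewrite lerN2.
Qed.

(** The variation of [(z - 1/2) ln z - z] from [y] to [y + d] is [d * ln y] up to [y^-1], in the
    form in which both [stirling_defect_shift] and the limit in [lnGamma_expansion] meet it. *)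
Lemma ln_ratio_bound (R : realType) (y d : R) : 1 <= y -> 0 <= d <= 1 ->
  `|(y + d - 2^-1) * (ln (y + d) - ln y) - d| <= y^-1.
Proof.
move=> y1 /andP[d0 d1]; have y0 : 0 < y by apply: lt_le_trans y1.
have yd0 : 0 < y + d by rewrite ltr_wpDr.
have u0 : 0 <= d / y by rewrite divr_ge0// ltW.
rewrite -ln_div ?posrE//; have -> : (y + d) / y = 1 + d / y by field; rewrite gt_eqF.
have /andP[l1 l2] := ln1D_bounds u0.
have a0 : 0 <= y + d - 2^-1 by lra.
rewrite ler_norml; apply/andP; split.
  apply: le_trans (lerB (ler_wpM2l a0 l1) (lexx d)).
  rewrite (_ : _ - d = - (d / (2 * (y + d)))); last first.
    by field; rewrite gt_eqF//= gt_eqF// .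
  rewrite lerN2 ler_pdivrMr ?mulr_gt0// [X in _ <= X]mulrC ler_pdivlMr//.
  by nra.
apply: le_trans (lerB (ler_wpM2l a0 l2) (lexx d)) _.
rewrite (_ : _ - d = (d * (d - 2^-1)) / y); last by field; rewrite gt_eqF.
by rewrite ler_pdivrMr// mulVf ?gt_eqF//; nra.
Qed.

(* Locking keeps unification from unfolding the integral that defines [Gamma]. *)
Fact lnGamma_key : unit. Proof. exact: tt. Qed.
Definition lnGamma (R : realType) : R -> R :=
  locked_with lnGamma_key (fun x => ln (Gamma x)).

Lemma lnGammaE (R : realType) (x : R) : lnGamma x = ln (Gamma x).
Proof. by rewrite /lnGamma unlock. Qed.

Lemma expR_lnGamma (R : realType) (x : R) : 0 < x -> expR (lnGamma x) = Gamma x.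
Proof. by move=> x0; rewrite lnGammaE lnK// posrE; exact: Gamma_gt0. Qed.

Lemma lnGammaD1 (R : realType) (x : R) : 0 < x -> lnGamma (x + 1) = ln x + lnGamma x.
Proof.
move=> x0; rewrite !lnGammaE (GammaD1 x0) lnM ?posrE//; exact: Gamma_gt0.
Qed.

Lemma lnGamma1 (R : realType) : lnGamma (1 : R) = 0.
Proof. by rewrite lnGammaE (Gamma_nat R 0) fact0 ln1. Qed.

Lemma lnGamma_half (R : realType) : lnGamma (2^-1 : R) = ln pi / 2.
Proof.
by rewrite lnGammaE Gamma_half -(powR12_sqrt (pi_ge0 R)) ln_powR mulrC.
Qed.

Lemma ln_le_powRM (R : realType) (a b y s : R) : 0 < a -> 0 < b -> 0 < y ->
  a <= y `^ s * b -> ln a <= s * ln y + ln b.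
Proof.
move=> a0 b0 y0; have ys0 : 0 < y `^ s by rewrite powR_gt0.
by rewrite -ln_powR -lnM ?posrE// ler_ln ?posrE// mulr_gt0.
Qed.

Lemma lnGammaD_le (R : realType) (x s : R) : 0 < x -> 0 <= s <= 1 ->
  lnGamma (x + s) <= s * ln x + lnGamma x.
Proof.
move=> x0 s01; have xs0 : 0 < x + s by case/andP: s01 => s0 _; rewrite ltr_wpDr.
rewrite !lnGammaE.
exact: (ln_le_powRM (Gamma_gt0 xs0) (Gamma_gt0 x0) x0 (GammaD_le x0 s01)).
Qed.

(** What remains of [lnGamma] after the leading terms of Stirling's formula. It involves neither [h]
    nor a truncation order, so a single limit fixes the constant of every expansion. *)
Definition stirling_defect (R : realType) (z : R) : R :=
  lnGamma z - (z - 2^-1) * ln z + z.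

(** [GammaD_le] from [y] to [y + s] bounds from above; from [y + s] to [y + 1], with exponent
    [1 - s], it bounds from below. The gap is [(1 - s) (ln (y + s) - ln y)], at most
    [(1 - s) s / y]. *)
Lemma lnGamma_shift_bound (R : realType) (y s : R) : 0 < y -> 0 <= s <= 1 ->
  `|lnGamma (y + s) - lnGamma y - s * ln y| <= y^-1.
Proof.
move=> y0 s01; have /andP[s0 s1] := s01; have ys0 : 0 < y + s by rewrite ltr_wpDr.
have u0 : 0 <= s / y by rewrite divr_ge0// ltW.
have /andP[_] := ln1D_bounds u0.
have -> : ln (1 + s / y) = ln (y + s) - ln y.
  by rewrite -ln_div ?posrE//; congr ln; field; rewrite gt_eqF.
move=> l2.
have sy : (1 - s) * (ln (y + s) - ln y) <= y^-1.
  apply: (@le_trans _ _ ((1 - s) * (s / y))); first by rewrite ler_wpM2l// subr_ge0.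
  by rewrite mulrA ler_pdivrMr// mulVf ?gt_eqF//; nra.
have up := lnGammaD_le y0 s01.
have := @lnGammaD_le R (y + s) (1 - s) ys0.
rewrite (_ : y + s + (1 - s) = y + 1); last by ring.
rewrite subr_ge0 s1 lerBlDr lerDl s0 (lnGammaD1 y0) => /(_ isT) lo.
have y'0 : 0 < y^-1 by rewrite invr_gt0.
rewrite ler_norml; apply/andP; split; lra.
Qed.

Lemma stirling_defect_shift (R : realType) (y s : R) : 1 <= y -> 0 <= s <= 1 ->
  `|stirling_defect (y + s) - stirling_defect y| <= 2 * y^-1.
Proof.
move=> y1 s01; have y0 : 0 < y by apply: lt_le_trans y1.
have := lnGamma_shift_bound y0 s01; have := ln_ratio_bound y1 s01.
rewrite /stirling_defect => h1 h2.
rewrite (_ : _ - _ = (lnGamma (y + s) - lnGamma y - s * ln y) -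
  ((y + s - 2^-1) * (ln (y + s) - ln y) - s)); last by ring.
rewrite (_ : 2 * y^-1 = y^-1 + y^-1); last by ring.
by apply: le_trans (ler_normB _ _) _; rewrite lerD.
Qed.

(** Legendre's duplication formula at positive integers, where induction on the functional equation
    suffices. Its base case is where [Gamma (1/2)] enters. *)
Lemma lnGamma_duplication_nat (R : realType) (n : nat) (y := n.+1%:R : R) :
  lnGamma y + lnGamma (y + 2^-1) = (1 - 2 * y) * ln 2 + ln pi / 2 + lnGamma (2 * y).
Proof.
rewrite /y {y}; elim: n => [|n].
  rewrite mulr1 lnGamma1 [1 + 2^-1]addrC lnGammaD1 ?invr_gt0// lnGamma_half.
  rewrite (_ : 2 = 1 + 1 :> R)// lnGammaD1// lnGamma1 ln1 lnV ?posrE//; ring.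
rewrite -[n.+2%:R]natr1; set y : R := n.+1%:R => ih.
have y0 : 0 < y by [].
have y20 : 0 < y + 2^-1 by rewrite addr_gt0.
have y30 : 0 < 2 * y by rewrite mulr_gt0.
have y40 : 0 < 2 * y + 1 by rewrite addr_gt0.
have -> : y + 1 + 2^-1 = y + 2^-1 + 1 by rewrite addrAC.
have -> : 2 * (y + 1) = 2 * y + 1 + 1 by ring.
rewrite (lnGammaD1 y0) (lnGammaD1 y20) (lnGammaD1 y40) (lnGammaD1 y30).
have -> : 2 * y + 1 = 2 * (y + 2^-1) by field.
rewrite !lnM ?posrE//.
move: ih; move: (lnGamma y) (lnGamma (y + 2^-1)) (lnGamma (2 * y)) => a b c ih.
by rewrite addrACA ih; field.
Qed.

Lemma stirling_shift1E (R : realType) (z : R) :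
  lnGamma z - stirling_shift 1 0 z = stirling_defect z - bernoulli_egf (0 : R) 2 * z^-1.
Proof.
rewrite /stirling_shift !big_ord_recl big_ord0 /= bernoulli_egf0 bernoulli_egf1.
by rewrite fact0 expr0 expr1 /stirling_defect; ring.
Qed.

(** At order 0, [stirling_shift_diff] bounds a step only by a multiple of [y^-1], which is not
    summable. Order 1 is telescoped instead, and its extra term in [z^-1] is then paid for at both
    ends. *)
Lemma stirling_defect_nat_steps (R : realType) : exists K : R,
  forall m n, (m <= n)%N -> `|stirling_defect n.+1%:R - stirling_defect m.+1%:R| <= K / m.+1%:R.
Proof.
have [K K0 hK] := stirling_shift_diff R 1.
pose B : R := `|bernoulli_egf (0 : R) 2|.
exists (2 * K + B + B) => m n mn.
pose E z : R := lnGamma z - stirling_shift 1 0 z.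
have m1 : 1 <= m.+1%:R :> R by rewrite ler1n.
have := @telescope_bound R E K 0 m.+1%:R K0 m1 _ (n - m).
have -> : m.+1%:R + (n - m)%:R = n.+1%:R :> R by rewrite -natrD addSn subnKC.
move=> h; have {}h : `|E n.+1%:R - E m.+1%:R| <= 2 * K / m.+1%:R.
  apply: le_trans (h _) _ => [y my|].
    have y0 : 0 < y by apply: lt_le_trans my.
    rewrite /E lnGammaD1//.
    have := hK 0 y; rewrite lexx ler01 addr0 => /(_ isT y0).
    rewrite distrC; congr (_ <= _); congr `|_|; ring.
  by rewrite expr0 mulr1 ler_wpM2l ?mulr_ge0// lerBlDr lerDl invr_ge0.
have hn : n.+1%:R^-1 <= m.+1%:R^-1 :> R by rewrite lef_pV2 ?posrE// ler_nat.
rewrite /E !stirling_shift1E in h.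
rewrite (_ : _ - _ = (stirling_defect n.+1%:R - bernoulli_egf 0 2 * n.+1%:R^-1
   - (stirling_defect m.+1%:R - bernoulli_egf 0 2 * m.+1%:R^-1)) +
   bernoulli_egf 0 2 * n.+1%:R^-1 - bernoulli_egf 0 2 * m.+1%:R^-1); last by ring.
apply: le_trans (ler_normB _ _) _; rewrite mulrDl lerD//; last first.
  by rewrite normrM (ger0_norm (x := _^-1)) ?invr_ge0.
apply: le_trans (ler_normD _ _) _; rewrite mulrDl lerD//.
by rewrite normrM (ger0_norm (x := _^-1)) ?invr_ge0// ler_wpM2l.
Qed.

Lemma cvg_harmonicM (R : realType) (K : R) : K / n.+1%:R @[n --> \oo] --> (0 : R).
Proof.
by rewrite -[X in _ --> X](mulr0 K); apply: cvgM; [exact: cvg_cst|exact: cvg_harmonic].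
Qed.

Lemma is_cvg_harmonic_steps (R : realType) (u : nat -> R) (K : R) :
  (forall m n, (m <= n)%N -> `|u n - u m| <= K / m.+1%:R) -> cvg (u n @[n --> \oo]).
Proof.
move=> hu; apply/cauchy_cvgP/cauchyP => e e0.
have /cvgrPdist_lt/(_ _ e0) [N _ /(_ N (leqnn N))/=] := @cvg_harmonicM R K.
rewrite sub0r normrN => hN; exists (u N), N => // n /= Nn.
rewrite -ball_normE /= distrC; apply: le_lt_trans (hu _ _ Nn) _.
exact: le_lt_trans (ler_norm _) hN.
Qed.

Lemma cvg_harmonic_le (R : realType) (u : nat -> R) (l K : R) :
  (forall n, `|u n - l| <= K / n.+1%:R) -> u n @[n --> \oo] --> l.
Proof.
move=> hu; apply/cvgrPdist_lt => e e0.
have /cvgrPdist_lt/(_ _ e0) [N _ hN] := @cvg_harmonicM R K.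
exists N => // n Nn; rewrite /= distrC; apply: le_lt_trans (hu n) _.
have := hN n Nn; rewrite /= sub0r normrN; apply: le_lt_trans; exact: ler_norm.
Qed.

Lemma cvgr_sub0 (R : realType) (u v : nat -> R) (l : R) :
  u n - v n @[n --> \oo] --> 0 -> v n @[n --> \oo] --> l -> u n @[n --> \oo] --> l.
Proof.
move=> uv vl; rewrite (_ : u = fun n => u n - v n + v n); last first.
  by apply/funext => n; rewrite subrK.
by rewrite -[l]add0r; exact: cvgD.
Qed.

(** The limit [c] exists by the Cauchy criterion. In the duplication formula the defects at [y],
    [y + 1/2] and [2 y] all tend to [c], so [c + c - c] is the explicit constant. *)
Lemma cvg_stirling_defect_nat (R : realType) :
  (stirling_defect n.+1%:R : R) @[n --> \oo] --> ln (2 * pi) / 2.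
Proof.
have [K hK] := stirling_defect_nat_steps R.
have /cvg_ex[/= c hc] := is_cvg_harmonic_steps hK.
suff -> : ln (2 * pi) / 2 = c by [].
pose w n : R := stirling_defect (n.+1%:R + 2^-1) - stirling_defect n.+1%:R.
have hw : w n @[n --> \oo] --> 0.
  apply: (@cvg_harmonic_le _ _ _ 2) => n; rewrite subr0.
  by apply: stirling_defect_shift; rewrite ?ler1n// invr_ge0 ler0n invf_le1// ler1n.
pose v n : R := (n.+1%:R + 2^-1 - 2^-1) * (ln (n.+1%:R + 2^-1) - ln n.+1%:R) - 2^-1.
have hv : v n @[n --> \oo] --> 0.
  apply: (@cvg_harmonic_le _ _ _ 1) => n; rewrite subr0 div1r.
  by apply: ln_ratio_bound; rewrite ?ler1n// invr_ge0 ler0n invf_le1// ler1n.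
have h2 : (stirling_defect (2 * n.+1%:R) : R) @[n --> \oo] --> c.
  have -> : (fun n => stirling_defect (2 * n.+1%:R) : R) =
     (fun n => stirling_defect n.+1%:R) \o (fun n => (2 * n).+1).
    by apply/funext => n; rewrite /comp -natrM mulnS.
  apply: cvg_comp hc.
  apply/cvgnyPge => A; exists A => // n /= An.
  by rewrite (leq_trans An)// mul2n -addnn -addnS leq_addr.
have e n : stirling_defect n.+1%:R + stirling_defect (n.+1%:R + 2^-1)
    - stirling_defect (2 * n.+1%:R) = ln (2 * pi) / 2 - v n.
  set y : R := n.+1%:R; have y0 : 0 < y by [].
  have h := @lnGamma_duplication_nat R n; rewrite -/y in h.
  rewrite /stirling_defect /v -/y.
  rewrite !lnM ?posrE ?pi_gt0//.
  rewrite (_ : lnGamma (2 * y) = lnGamma y + lnGamma (y + 2^-1)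
    - ((1 - 2 * y) * ln 2 + ln pi / 2)); last by rewrite h; ring.
  by field.
have lhs : (stirling_defect n.+1%:R + stirling_defect (n.+1%:R + 2^-1)
    - stirling_defect (2 * n.+1%:R) : R) @[n --> \oo] --> c + (0 + c) - c.
  apply: cvgB => //; apply: cvgD => //.
  rewrite (_ : (fun n => stirling_defect (n.+1%:R + 2^-1)) = (fun n => w n + stirling_defect
      n.+1%:R)); last first.
    by apply/funext => n; rewrite /w subrK.
  exact: cvgD.
have rhs : (stirling_defect n.+1%:R + stirling_defect (n.+1%:R + 2^-1)
    - stirling_defect (2 * n.+1%:R) : R) @[n --> \oo] --> ln (2 * pi) / 2 - 0.
  by under eq_fun do rewrite e; apply: cvgB => //; exact: cvg_cst.
have := cvg_unique _ rhs lhs; rewrite subr0 add0r addrK; exact.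
Qed.

Lemma cvg_stirling_defect (R : realType) (z : R) : 0 < z ->
  (stirling_defect (z + n%:R) : R) @[n --> \oo] --> ln (2 * pi) / 2.
Proof.
move=> z0; set k := Num.trunc z.
have /andP[kz zk] := Num.Theory.truncn_itv (ltW z0).
rewrite -/k in kz zk.
pose s := z - k%:R.
have s01 : 0 <= s <= 1 by rewrite subr_ge0 kz lerBlDr nat1r ltW.
rewrite -(cvg_shiftS (fun n => stirling_defect (z + n%:R) : R)).
have hw : (stirling_defect (z + n.+1%:R) - stirling_defect (k + n).+1%:R : R) @[n --> \oo]
    --> 0.
  apply: (@cvg_harmonic_le _ _ _ 2) => n; rewrite subr0.
  have -> : z + n.+1%:R = (k + n).+1%:R + s by rewrite /s -addnS natrD; ring.
  apply: le_trans (stirling_defect_shift _ s01) _; first by rewrite ler1n.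
  by rewrite ler_wpM2l// lef_pV2 ?posrE// ler_nat ltnS leq_addl.
have h1 : (stirling_defect (k + n).+1%:R : R) @[n --> \oo] --> ln (2 * pi) / 2.
  have -> : (fun n => stirling_defect (k + n).+1%:R : R) =
    (fun n => stirling_defect n.+1%:R) \o (fun n => (k + n)%N) by [].
  apply: cvg_comp (@cvg_stirling_defect_nat R).
  by apply/cvgnyPge => A; exists A => // n /= An; rewrite (leq_trans An)// leq_addl.
exact: cvgr_sub0 hw h1.
Qed.

Lemma stirling_shiftE (R : realType) (N : nat) (h x : R) :
  stirling_shift N h x = x * ln x - x + (h - 2^-1) * ln x +
  \sum_(j < N) bernoulli_egf h j.+2 * ((- 1) ^+ j * j`!%:R) * x^-1 ^+ j.+1.
Proof.
rewrite /stirling_shift !big_ord_recl bernoulli_egf0 bernoulli_egf1 mul1r addrA.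
by congr (_ + _); apply: eq_bigr => j _; rewrite !lift0 [X in _ * X]/= mulrA.
Qed.

(** The telescoped bound on [E (x + m) - E x] is uniform in [m], and [E (x + m)] tends to Stirling's
    constant because [E] differs from the defect by a multiple of the inverse argument. Letting [m]
    grow gives the estimate at [x]. *)
Lemma lnGamma_expansion (R : realType) (N : nat) : exists2 K : R, 0 <= K &
  forall h x : R, 0 <= h <= 1 -> 1 <= x ->
  `|lnGamma (x + h) - (ln (2 * pi) / 2 + stirling_shift N.+1 h x)| <= K * x^-1 ^+ N.+1.
Proof.
have [K K0 hK] := stirling_shift_diff R N.+1.
exists (2 * K) => [|h x h01 x1]; first by rewrite mulr_ge0.
have x0 : 0 < x by apply: lt_le_trans x1.
have /andP[h0 h1] := h01.
pose E y := lnGamma (y + h) - stirling_shift N.+1 h y.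
have step y : x <= y -> `|E (y + 1) - E y| <= K * y^-1 ^+ N.+2.
  move=> xy; have y0 : 0 < y by apply: lt_le_trans xy.
  have := hK h y h01 y0; rewrite /E [y + 1 + h]addrAC lnGammaD1 ?ltr_wpDr// distrC.
  by rewrite (_ : ln _ - _ = ln (y + h) + lnGamma (y + h) - stirling_shift N.+1 h (y + 1) -
    (lnGamma (y + h) - stirling_shift N.+1 h y)); last ring.
have tel m : `|E (x + m%:R) - E x| <= 2 * K * x^-1 ^+ N.+1.
  apply: le_trans (telescope_bound K0 x1 step m) _.
  rewrite [x^-1 ^+ N.+1]exprSr mulrA ler_wpM2l ?mulr_ge0 ?exprn_ge0 ?invr_ge0 ?(ltW x0)//.
  by rewrite lerBlDr lerDl invr_ge0 addr_ge0// ltW.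
have limE : E (x + m%:R) @[m --> \oo] --> ln (2 * pi) / 2.
  pose B : R := \sum_(j < N.+1) `|bernoulli_egf h j.+2 * ((- 1) ^+ j * j`!%:R)|.
  have hd : E (x + m%:R) - stirling_defect (x + h + m%:R) @[m --> \oo] --> 0.
    apply: (@cvg_harmonic_le _ _ _ (1 + B)) => m; rewrite subr0.
    rewrite [x + h + m%:R]addrAC; set y := x + m%:R.
    have y1 : 1 <= y by rewrite (le_trans x1)// lerDl.
    have y0 : 0 < y by apply: lt_le_trans y1.
    have ym : y^-1 <= m.+1%:R^-1.
      by rewrite lef_pV2 ?posrE// -natr1 addrC /y lerD2r.
    have B0 : 0 <= B by apply: sumr_ge0.
    apply: (@le_trans _ _ ((1 + B) * y^-1)); last by rewrite ler_wpM2l// addr_ge0.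
    rewrite /E stirling_shiftE /stirling_defect.
    set S := \sum_(j < N.+1) _.
    rewrite (_ : _ - _ = ((y + h - 2^-1) * (ln (y + h) - ln y) - h) - S); last by ring.
    apply: le_trans (ler_normB _ _) _; rewrite [(1 + B) * _]mulrDl mul1r lerD//.
      exact: ln_ratio_bound.
    apply: le_trans (ler_norm_sum _ _ _) _; rewrite /B mulr_suml.
    apply: ler_sum => j _; rewrite normrM ler_wpM2l// normrX ger0_norm ?invr_ge0 ?(ltW y0)//.
    by rewrite exprS ler_piMr ?invr_ge0 ?(ltW y0)// exprn_ile1 ?invr_ge0 ?(ltW y0)// invf_le1.
  have xh0 : 0 < x + h by rewrite ltr_wpDr.
  exact: cvgr_sub0 hd (cvg_stirling_defect xh0).
rewrite (_ : _ - _ = E x - ln (2 * pi) / 2); last by rewrite /E; ring.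
have hl : `|E x - E (x + m%:R)| @[m --> \oo] --> `|E x - ln (2 * pi) / 2|.
  by apply: cvg_norm; apply: cvgB => //; exact: cvg_cst.
by apply: (cvgr_to_le hl); apply: nearW => m; rewrite distrC.
Qed.

(** * Exponentials of asymptotic expansions *)

(** [B] is chosen before the sequence [a]: this is what later makes the error uniform in [h] and
    [p]. *)
Lemma exp_coef_bounded (R : realType) (M : nat) (A : R) : 0 <= A ->
  exists2 B : R, 0 <= B & forall a : nat -> R,
    (forall k, (0 < k <= M)%N -> `|a k| <= A) ->
    forall n, (n <= M)%N -> `|exp_coef a n| <= B.
Proof.
move=> A0.
suff h n : exists2 B : R, 0 <= B & forall a : nat -> R,
    (forall k, (0 < k <= M)%N -> `|a k| <= A) ->
    forall i, (i <= M)%N -> (i <= n)%N -> `|exp_coef a i| <= B.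
  have [B B0 hB] := h M; exists B => // a ha n nM; exact: hB.
elim: n => [|n [B B0 ih]].
  exists 1 => // a ha i _; rewrite leqn0 => /eqP ->; by rewrite exp_coef0 normr1.
pose B' : R := \sum_(1 <= k < n.+2) k%:R * A * B.
have B'0 : 0 <= B' by apply: sumr_ge0 => k _; rewrite !mulr_ge0.
exists (B + B') => [|a ha i iM]; first exact: addr_ge0.
rewrite leq_eqVlt => /predU1P[iE|]; last first.
  by rewrite ltnS => ni; rewrite (le_trans (ih a ha i iM ni))// lerDl.
rewrite iE exp_coefS// normrM ger0_norm ?invr_ge0//.
apply: (@le_trans _ _ B'); last by rewrite lerDr.
apply: (@le_trans _ _ `|\sum_(1 <= k < n.+2) k%:R * a k * exp_coef a (n.+1 - k)|).
  by rewrite ler_piMl// invf_le1// ler1n.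
apply: le_trans (ler_norm_sum _ _ _) _.
rewrite /B' big_nat_cond [X in _ <= X]big_nat_cond; apply: ler_sum => k /andP[/andP[k1 kn] _].
rewrite !normrM normr_nat ler_pM ?mulr_ge0// ?ler_wpM2l//.
  by apply: ha; rewrite k1 (leq_trans _ iM)// iE -ltnS.
apply: ih => //; last by rewrite leq_subLR -addn1 addnC leq_add2r.
by rewrite (leq_trans (leq_subr _ _))// -iE.
Qed.

Lemma horner_norm_le (R : realType) (p : {poly R}) (n M : nat) (B z : R) :
  (size p <= n)%N -> (forall i, (i < M)%N -> p`_i = 0) -> (forall i, `|p`_i| <= B) ->
  0 <= z <= 1 -> `|p.[z]| <= n%:R * B * z ^+ M.
Proof.
move=> sp p0 pB /andP[z0 z1]; rewrite (horner_coef_wide z sp).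
apply: le_trans (ler_norm_sum _ _ _) _.
apply: (@le_trans _ _ (\sum_(i < n) B * z ^+ M)); last first.
  by rewrite sumr_const card_ord -mulrA mulr_natl.
apply: ler_sum => i _; rewrite normrM normrX (ger0_norm z0).
have B0 : 0 <= B by exact: le_trans (pB 0%N).
case: (ltnP i M) => iM; first by rewrite p0// normr0 mul0r mulr_ge0// exprn_ge0.
by rewrite ler_pM ?exprn_ge0// ler_wiXn2l.
Qed.

Lemma leq_size_deriv (R : realType) (p : {poly R}) : (size p^`() <= size p)%N.
Proof. by rewrite /deriv (leq_trans (size_poly _ _))// leq_pred. Qed.

(* With [D] and [P] the truncations of the two series, [D e^(-P)] has derivative
   [(D' - D P') e^(-P)], and the recurrence for the [d_m] says exactly that
   [D' - D P'] vanishes to order [M]. *)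
Lemma exp_expansion (R : realType) (M : nat) (A : R) : 0 <= A ->
  exists2 C : R, 0 <= C & forall a : nat -> R,
    (forall k, (0 < k <= M)%N -> `|a k| <= A) ->
    forall z : R, 0 <= z <= 1 ->
    `|expR (\sum_(j < M) a j.+1 * z ^+ j.+1) - \sum_(n < M.+1) exp_coef a n * z ^+ n|
      <= C * z ^+ M.+1.
Proof.
move=> A0; have [B B0 hB] := exp_coef_bounded M A0.
(* [W] bounds the coefficients of [Q = D' - D P'], whose size is at most [M.+1 + M.+1]; [V] bounds
   the exponentials of [P] and of [- P] on [0, 1], each of which occurs once. *)
pose W : R := M.+1%:R * B + (M.+1 + M.+1)%:R * (B * (M.+1%:R * A)).
pose V := expR (M%:R * A).
exists (V * ((M.+1 + M.+1)%:R * W * V)) => [|a ha z z01].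
  by rewrite !mulr_ge0 ?addr_ge0 ?mulr_ge0 ?expR_ge0.
have /andP[z0 z1] := z01.
pose D := \poly_(i < M.+1) exp_coef a i.
pose P := \poly_(i < M.+1) (if i is 0%N then 0 else a i).
have PE s : P.[s] = \sum_(j < M) a j.+1 * s ^+ j.+1.
  by rewrite horner_poly big_ord_recl mul0r add0r.
have DE s : D.[s] = \sum_(n < M.+1) exp_coef a n * s ^+ n by rewrite horner_poly.
rewrite -PE -DE.
pose Q := D^`() - D * P^`().
have P'B i : `|P^`()`_i| <= M.+1%:R * A.
  rewrite coef_deriv coef_poly; case: ltnP => iM; last by rewrite mul0rn normr0 mulr_ge0.
  rewrite normrMn -[X in X <= _]mulr_natl ler_pM// ?ler_nat ?(ltnW iM)//.
  by apply: ha; rewrite /= -ltnS.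
have DB i : `|D`_i| <= B.
  by rewrite coef_poly; case: ltnP => iM; [exact: hB|rewrite normr0].
have QB i : `|Q`_i| <= W.
  rewrite coefB; apply: le_trans (ler_normB _ _) _; rewrite lerD//.
    rewrite coef_deriv normrMn -[X in X <= _]mulr_natl.
    case: (ltnP i.+1 M.+1) => iM; last by rewrite coef_poly ltnNge iM/= normr0 mulr0 mulr_ge0.
    by rewrite ler_pM// ler_nat ltnW.
  have [iM|Mi] := ltnP i (M.+1 + M.+1); last first.
    rewrite nth_default ?normr0 ?mulr_ge0// (leq_trans _ Mi)//.
    apply: leq_trans (size_mul_leq _ _) _; rewrite (leq_trans (leq_pred _))// leq_add
        ?size_poly//.
    by rewrite (leq_trans (leq_size_deriv _))// size_poly.
  rewrite coefM; apply: le_trans (ler_norm_sum _ _ _) _.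
  apply: (@le_trans _ _ (\sum_(j < i.+1) B * (M.+1%:R * A))).
    by apply: ler_sum => j _; rewrite normrM ler_pM.
  rewrite sumr_const card_ord -[X in X <= _]mulr_natl ler_wpM2r ?mulr_ge0// ler_nat//.
have Q0 i : (i < M)%N -> Q`_i = 0.
  move=> iM; rewrite coefB coef_deriv coef_poly ltnS iM coefMr.
  rewrite -[exp_coef a i.+1 *+ _]mulr_natl exp_coefS// mulrA mulfV ?pnatr_eq0// mul1r.
  rewrite big_add1/= big_mkord; apply/eqP; rewrite subr_eq0; apply/eqP.
  apply: eq_bigr => j _; rewrite coef_deriv !coef_poly.
  have ji : (j <= i)%N by rewrite -ltnS.
  rewrite subSS !ltnS (leq_ltn_trans ji iM) (leq_trans (leq_subr _ _) (ltnW iM)).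
  by rewrite -[a j.+1 *+ _]mulr_natl mulrC.
have sQ : (size Q <= M.+1 + M.+1)%N.
  rewrite (leq_trans (size_polyD _ _))// size_polyN geq_max; apply/andP; split.
    by rewrite (leq_trans (leq_size_deriv _))// (leq_trans _ (leq_addr _ _))// size_poly.
  apply: leq_trans (size_mul_leq _ _) _; rewrite (leq_trans (leq_pred _))// leq_add
      ?size_poly//.
  by rewrite (leq_trans (leq_size_deriv _))// size_poly.
have PV s : 0 <= s <= 1 -> `|P.[s]| <= M%:R * A.
  move=> /andP[s0 s1]; rewrite PE; apply: le_trans (ler_norm_sum _ _ _) _.
  apply: (@le_trans _ _ (\sum_(j < M) A)); last by rewrite sumr_const card_ord mulr_natl.
  apply: ler_sum => j _; rewrite normrM normrX (ger0_norm s0) -[X in _ <= X]mulr1.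
  rewrite ler_pM ?exprn_ge0// ?exprn_ile1//.
  by apply: ha; rewrite /= ltn_ord.
pose g s := D.[s] * expR (- P.[s]).
pose dg s := Q.[s] * expR (- P.[s]).
have dgE s : 0 <= s <= z -> is_derive s 1 g (dg s).
  move=> _.
  have hD := is_derive_poly D s.
  have hP := is_deriveN (is_derive_poly P s).
  have hE := @is_derive1_comp R expR (fun s => - P.[s]) s _ _ (is_derive_expR _) hP.
  apply: (is_derive_eq (is_deriveM hD hE)).
  rewrite /dg /Q /GRing.scale/= hornerD hornerN hornerM.
  by move: D.[s] P^`().[s] D^`().[s] (expR _) => u v w t; ring.
have hg : `|g z - g 0| <= (M.+1 + M.+1)%:R * W * V * z ^+ M * z.
  apply: derive_bound dgE _ => // s /andP[s0 sz].
  have s01 : 0 <= s <= 1 by rewrite s0 (le_trans sz).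
  rewrite /dg normrM (ger0_norm (expR_ge0 _)).
  have W0 : 0 <= W by rewrite addr_ge0 ?mulr_ge0.
  rewrite -[X in _ <= X]mulrA [V * _]mulrC mulrA ler_pM ?expR_ge0//.
    apply: le_trans (horner_norm_le sQ Q0 QB s01) _.
    by rewrite ler_wpM2l ?mulr_ge0// lerXn2r ?nnegrE.
  by rewrite ler_expR (le_trans _ (PV s s01))// -normrN ler_norm.
have g0 : g 0 = 1.
  by rewrite /g PE DE big_ord_recl exp_coef0 expr0 mulr1 !big1 ?addr0 ?oppr0 ?expR0 ?mulr1// =>
    j _; rewrite ?lift0 expr0n/= mulr0.
have -> : expR P.[z] - D.[z] = - (expR P.[z] * (g z - g 0)).
  rewrite g0 /g mulrBr mulr1 mulrCA -expRD subrr expR0 mulr1; ring.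
rewrite normrN normrM (ger0_norm (expR_ge0 _)) -mulrA ler_pM ?expR_ge0//.
  by rewrite ler_expR (le_trans _ (PV z z01))// ler_norm.
by rewrite exprSr mulrA.
Qed.

Lemma expR_sub1_le (R : realType) (u : R) : `|expR u - 1| <= `|u| * expR `|u|.
Proof.
have h1 := expR_ge1Dx u; have h2 := expR_ge1Dx (- u).
have e0 := expR_gt0 u.
have h3 : expR u - 1 <= u * expR u.
  have : (1 - u) * expR u <= 1.
    by rewrite -ler_pdivlMr// mul1r -expRN.
  by rewrite mulrBl mul1r; lra.
have [u0|u0] := leP 0 u.
  rewrite (ger0_norm u0) ger0_norm// subr_ge0.
  by apply: le_trans h1; rewrite lerDl.
rewrite (ltr0_norm u0) ltr0_norm; last by rewrite subr_lt0 -expR0 ltr_expR.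
apply: (@le_trans _ _ (- u)); first by lra.
by rewrite ler_peMr ?oppr_ge0 ?(ltW u0)// -expR0 ler_expR oppr_ge0 ltW.
Qed.

(** * Expansion of the normalised Gamma quotient, uniform in [h] and [p] *)

Lemma atilde_bernoulli (R : realType) (j : nat) (h p : R) :
  atilde j.+1 h p = (- 1) ^+ j * j`!%:R *
    ((p ^+ j.+1 - (p / (1 - p)) ^+ j.+1) * bernoulli_egf h j.+2 - bernoulli_egf 0 j.+2).
Proof.
rewrite /atilde /bernoulli_number /bernoulli_egf !exprS !mulN1r opprK.
move: (bernoulli_poly R j.+2).[h] (bernoulli_poly R j.+2).[0] (p ^+ j) ((p / (1 - p)) ^+ j)
    => a b c d.
rewrite !factS !natrM; set u := (- 1) ^+ j.
have : j`!%:R != 0 :> R by rewrite pnatr_eq0 -lt0n fact_gt0.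
have : j.+1%:R != 0 :> R by rewrite pnatr_eq0.
have : j.+2%:R != 0 :> R by rewrite pnatr_eq0.
move: (j.+2%:R : R) (j.+1%:R : R) (j`!%:R : R) (p / (1 - p)) => k l m e k0 l0 m0.
field.
by rewrite k0 l0 m0.
Qed.

(** The logarithm of the mean absolute deviation divided by its leading term, as [nb_ratioE] shows,
    with [nu] rewritten as [mu + h] and [h] set free. *)
Definition ln_nb_ratio (R : realType) (r p h : R) : R :=
  lnGamma (r / p + h) - lnGamma r - lnGamma (r * (1 - p) / p + h)
  + r * ln p + (r * (1 - p) / p + h) * ln (1 - p)
  + ln (2 * pi) / 2 - ln (r * (1 - p)) / 2.

(** Three instances of [lnGamma_expansion], at [r / p], [r] and [r (1 - p) / p]; their inverses are
    [p], 1 and [p / (1 - p)] times [r^-1], which explains the three terms of the error. *)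
Lemma ln_nb_ratio_expansion (R : realType) (N : nat) : exists2 K : R, 0 <= K &
  forall r p h : R, 0 < p < 1 -> 0 <= h <= 1 -> 1 <= r -> 1 <= r * (1 - p) / p ->
  `|ln_nb_ratio r p h - \sum_(j < N.+1) atilde j.+1 h p * r^-1 ^+ j.+1| <=
  K * (p ^+ N.+1 + 1 + (p / (1 - p)) ^+ N.+1) * r^-1 ^+ N.+1.
Proof.
have [K K0 hK] := lnGamma_expansion R N.
exists K => // r p h /andP[p0 p1] h01 r1 y1.
have r0 : 0 < r by apply: lt_le_trans r1.
have q0 : 0 < 1 - p by rewrite subr_gt0.
have x1 : 1 <= r / p.
  by rewrite ler_pdivlMr// mul1r (le_trans (ltW p1)).
have lx : ln (r / p) = ln r - ln p by rewrite ln_div ?posrE.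
have lq : ln (r * (1 - p)) = ln r + ln (1 - p) by rewrite lnM ?posrE.
have ly : ln (r * (1 - p) / p) = ln r + ln (1 - p) - ln p.
  by rewrite ln_div ?posrE ?mulr_gt0// lq.
have z01 : 0 <= (0 : R) <= 1.
  by rewrite lexx ler01.
have e1 := hK h (r / p) h01 x1; have e2 := hK 0 r z01 r1; have e3 := hK h _ h01 y1.
have xV : (r / p)^-1 = p * r^-1 by field; rewrite !gt_eqF.
have yV : (r * (1 - p) / p)^-1 = p / (1 - p) * r^-1 by field; rewrite !gt_eqF.
rewrite xV exprMn mulrA in e1; rewrite yV exprMn mulrA in e3.
rewrite !stirling_shiftE lx in e1; rewrite stirling_shiftE addr0 in e2.
rewrite !stirling_shiftE ly in e3.
have sumE : \sum_(j < N.+1) atilde j.+1 h p * r^-1 ^+ j.+1 =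
   \sum_(j < N.+1) bernoulli_egf h j.+2 * ((- 1) ^+ j * j`!%:R) * (r / p)^-1 ^+ j.+1
   - \sum_(j < N.+1) bernoulli_egf 0 j.+2 * ((- 1) ^+ j * j`!%:R) * r^-1 ^+ j.+1
   - \sum_(j < N.+1) bernoulli_egf h j.+2 * ((- 1) ^+ j * j`!%:R) * (r * (1 - p) / p)^-1 ^+
       j.+1.
  rewrite -!sumrB; apply: eq_bigr => j _.
  rewrite xV yV atilde_bernoulli [(p / r) ^+ _]exprMn [(p / (1 - p) / r) ^+ _]exprMn.
  by move: (p ^+ j.+1) ((p / (1 - p)) ^+ j.+1) (r^-1 ^+ j.+1) ((- 1) ^+ j : R) => a b c d';
      ring.
rewrite sumE; move: e1 e2 e3.
set S1 := \sum_(j < N.+1) _ * (r / p)^-1 ^+ j.+1.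
set S2 := \sum_(j < N.+1) _ * r^-1 ^+ j.+1.
set S3 := \sum_(j < N.+1) _.
rewrite /ln_nb_ratio lq.
move: (lnGamma (r / p + h)) (lnGamma r) (lnGamma (r * (1 - p) / p + h)) => g1 g2 g3 e1 e2 e3.
rewrite (_ : _ - _ = (g1 - (ln (2 * pi) / 2 + (r / p * (ln r - ln p) - r / p + (h - 2^-1) *
    (ln r - ln p) + S1)))
  - (g2 - (ln (2 * pi) / 2 + (r * ln r - r + (0 - 2^-1) * ln r + S2)))
  - (g3 - (ln (2 * pi) / 2 +
      (r * (1 - p) / p * (ln r + ln (1 - p) - ln p) - r * (1 - p) / p
        + (h - 2^-1) * (ln r + ln (1 - p) - ln p) + S3)))); last first.
  by field; rewrite gt_eqF.
apply: le_trans (ler_normB _ _) _.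
rewrite [K * (_ + _)]mulrDr [X in _ <= X]mulrDl lerD//.
apply: le_trans (ler_normB _ _) _.
rewrite [K * (_ + 1)]mulrDr mulr1 [(K * _ + K) * _]mulrDl; exact: lerD.
Qed.

Lemma atilde_bounded (R : realType) (M : nat) (e : R) : 0 < e -> e <= 1 ->
  exists2 A : R, 0 <= A & forall h p : R, 0 <= h <= 1 -> e <= p -> e <= 1 - p ->
    forall k, (0 < k <= M.+1)%N -> `|atilde k h p| <= A.
Proof.
move=> e0 e1; have [A A0 hA] := bernoulli_egf_bounded R M.+3.
exists (M`!%:R * ((1 + e^-1 ^+ M.+1) * A + A)).
  by rewrite mulr_ge0// !addr_ge0// mulr_ge0// addr_ge0// exprn_ge0// invr_ge0 ltW.
move=> h p h01 ep eq [//|j] /=; rewrite ltnS => jM.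
have p0 : 0 < p by apply: lt_le_trans ep.
have q0 : 0 < 1 - p by apply: lt_le_trans eq.
have p1 : p <= 1 by rewrite -subr_ge0 ltW.
have z01 : 0 <= (0 : R) <= 1.
  by rewrite lexx ler01.
rewrite atilde_bernoulli !normrM normrX normrN1 expr1n mul1r normr_nat.
rewrite ler_pM// ?ler_nat ?leq_fact//.
apply: le_trans (ler_normB _ _) _; rewrite lerD//; last by apply: hA.
rewrite normrM ler_pM//; last by apply: hA.
apply: le_trans (ler_normB _ _) _; rewrite !ger0_norm ?exprn_ge0 ?divr_ge0 ?(ltW p0) ?(ltW
    q0)//.
rewrite lerD// ?exprn_ile1 ?(ltW p0)//.
apply: (@le_trans _ _ (e^-1 ^+ j.+1)).
  rewrite lerXn2r ?nnegrE ?divr_ge0 ?invr_ge0 ?(ltW p0) ?(ltW q0) ?(ltW e0)//.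
  rewrite ler_pdivrMr// (le_trans p1)// ler_pdivlMl// mulr1//.
by rewrite ler_weXn2l// invf_ge1.
Qed.

(** The logarithm is known with a term of order [M.+1], which is moved into the error (the summand
    [A] of [K2]). Then [expR L - D] splits into [expR P (expR (L - P) - 1)] and [expR P - D]. *)
Lemma nb_ratio_expansion (R : realType) (M : nat) (e : R) : 0 < e -> e <= 1 ->
  exists C r0 : R, forall r p h : R, r0 <= r -> e <= p -> e <= 1 - p -> 0 <= h <= 1 ->
  `|expR (ln_nb_ratio r p h)
    - \sum_(n < M.+1) exp_coef (fun n => atilde n h p) n / r ^+ n| <= C * r ^- M.+1.
Proof.
move=> e0 e1.
have [K K0 hK] := ln_nb_ratio_expansion R M.
have [A A0 hA] := atilde_bounded M e0 e1.
have [C C0 hC] := exp_expansion M A0.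
pose K1 := K * (1 + 1 + e^-1 ^+ M.+1).
have K10 : 0 <= K1 by rewrite mulr_ge0// addr_ge0// exprn_ge0// invr_ge0 ltW.
pose K2 := K1 + A; have K20 : 0 <= K2 by rewrite addr_ge0.
(* From [r >= e^-1] follow [r >= 1] and [r (1 - p) >= 1 >= p], so every base point of the expansion
   is at least 1. *)
exists (expR (M%:R * A) * (K2 * expR K2) + C), e^-1.
move=> r p h er ep eq h01.
have p0 : 0 < p by apply: lt_le_trans ep.
have q0 : 0 < 1 - p by apply: lt_le_trans eq.
have p1 : p <= 1 by rewrite -subr_ge0 ltW.
have r1 : 1 <= r by rewrite (le_trans _ er)// invf_ge1.
have r0 : 0 < r by apply: lt_le_trans r1.
have pq0 : 0 <= p / (1 - p) by rewrite divr_ge0 ?ltW.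
have pqe : p / (1 - p) <= e^-1.
  by rewrite ler_pdivrMr// (le_trans p1)// ler_pdivlMl// mulr1.
have y1 : 1 <= r * (1 - p) / p.
  rewrite ler_pdivlMr// mul1r (le_trans p1)//.
  have : e^-1 * e <= r * (1 - p) by rewrite ler_pM ?invr_ge0 ?(ltW e0).
  by rewrite mulVf ?gt_eqF.
set z := r^-1.
have z0 : 0 <= z by rewrite invr_ge0 ltW.
have z1 : z <= 1 by rewrite invf_le1.
have z01 : 0 <= z <= 1 by rewrite z0 z1.
pose a n := atilde n h p.
have ha k : (0 < k <= M)%N -> `|a k| <= A.
  by move=> /andP[k0 kM]; apply: hA => //; rewrite k0 (leq_trans kM).
have p01 : 0 < p < 1 by rewrite p0 -subr_gt0.
have := hK r p h p01 h01 r1 y1; rewrite big_ord_recr/= -/z.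
set P := \sum_(j < M) _; set L := ln_nb_ratio r p h => hL.
have uK : `|L - P| <= K2 * z ^+ M.+1.
  rewrite (_ : L - P = (L - (P + atilde M.+1 h p * z ^+ M.+1)) + atilde M.+1 h p * z ^+
      M.+1); last by ring.
  apply: le_trans (ler_normD _ _) _; rewrite mulrDl lerD//.
    apply: le_trans hL _; rewrite ler_wpM2r ?exprn_ge0// ler_wpM2l//.
    rewrite !lerD// ?exprn_ile1 ?(ltW p0)//.
    by rewrite lerXn2r ?nnegrE ?invr_ge0 ?(ltW e0).
  rewrite normrM (ger0_norm (exprn_ge0 _ z0)) ler_wpM2r ?exprn_ge0//.
  by apply: hA => //=.
have uK2 : `|L - P| <= K2.
  by rewrite (le_trans uK)// ler_piMr// exprn_ile1.
have PA : expR P <= expR (M%:R * A).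
  rewrite ler_expR; apply: le_trans (ler_norm _) _; apply: le_trans (ler_norm_sum _ _ _) _.
  apply: (@le_trans _ _ (\sum_(j < M) A)); last by rewrite sumr_const card_ord mulr_natl.
  apply: ler_sum => j _; rewrite normrM (ger0_norm (exprn_ge0 _ z0)) -[X in _ <= X]mulr1.
  by rewrite ler_pM ?exprn_ge0// ?exprn_ile1//; apply: ha; rewrite /= ltn_ord.
have hD := hC a ha z z01; rewrite -/P in hD.
have -> : \sum_(n < M.+1) exp_coef (fun n => atilde n h p) n / r ^+ n =
   \sum_(n < M.+1) exp_coef a n * z ^+ n.
  by apply: eq_bigr => n _; rewrite /z exprVn.
set D := \sum_(n < M.+1) _ in hD *.
rewrite (_ : expR L - D = expR P * (expR (L - P) - 1) + (expR P - D)); last first.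
  by rewrite mulrBr mulr1 -expRD subrKC; ring.
rewrite -exprVn -/z.
apply: le_trans (ler_normD _ _) _; rewrite mulrDl lerD//.
rewrite normrM (ger0_norm (expR_ge0 _)) -!mulrA ler_pM ?expR_ge0//.
apply: le_trans (expR_sub1_le _) _.
by rewrite [expR K2 * _]mulrC mulrA ler_pM ?expR_ge0// ler_expR.
Qed.

(** * The negative binomial distribution *)

Lemma nb_pmf_ge0 (R : realType) (r p : R) (k : nat) : 0 < r -> 0 < p < 1 ->
  0 <= nb_pmf r p k.
Proof.
move=> r0 /andP[p0 p1]; rewrite /nb_pmf mulr_ge0 ?exprn_ge0 ?subr_ge0 ?(ltW p1)//.
by rewrite mulr_ge0 ?powR_ge0// divr_ge0 ?mulr_ge0// Gamma_ge0.
Qed.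

Lemma nb_pmf_rec (R : realType) (r p : R) (k : nat) : 0 < r ->
  k.+1%:R * nb_pmf r p k.+1 = (k%:R + r) * (1 - p) * nb_pmf r p k.
Proof.
move=> r0; rewrite /nb_pmf.
have kr0 : 0 < k%:R + r by rewrite ltr_wpDl.
have G0 : Gamma r != 0 by rewrite gt_eqF// Gamma_gt0.
have eR : Gamma (k.+1%:R + r) = (k%:R + r) * Gamma (k%:R + r).
  by rewrite -(GammaD1 kr0); congr Gamma; rewrite -natr1 addrAC.
have e1 : Gamma (k.+1%:R + 1) = (k.+1)`!%:R :> R by rewrite natr1; exact: Gamma_nat.
have e2 : Gamma (k%:R + 1) = k`!%:R :> R by rewrite natr1; exact: Gamma_nat.
rewrite eR e1 e2 factS natrM exprS.
have : k`!%:R != 0 :> R by rewrite pnatr_eq0 -lt0n fact_gt0.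
have : k.+1%:R != 0 :> R by rewrite pnatr_eq0.
move: G0; move: (Gamma r) (Gamma (k%:R + r)) (k.+1%:R : R) (k`!%:R : R) ((1 - p) ^+ k) (p `^ r).
move=> a b c d e f a0 c0 d0; field.
by rewrite a0 c0 d0.
Qed.

(* [T_k = k P(X = k) / p] telescopes the centred first moment. *)
Definition nb_tail (R : realType) (r p : R) (k : nat) : R := k%:R * nb_pmf r p k / p.

Lemma nb_tail0 (R : realType) (r p : R) : nb_tail r p 0 = 0.
Proof. by rewrite /nb_tail mul0r mul0r. Qed.

Lemma nb_tail_ge0 (R : realType) (r p : R) (k : nat) : 0 < r -> 0 < p < 1 ->
  0 <= nb_tail r p k.
Proof.
move=> r0 p01; have /andP[p0 _] := p01.
by rewrite /nb_tail divr_ge0 ?(ltW p0)// mulr_ge0// nb_pmf_ge0.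
Qed.

Lemma nb_tail_diff (R : realType) (r p : R) (k : nat) : 0 < r -> 0 < p < 1 ->
  nb_tail r p k - nb_tail r p k.+1 = (k%:R - nb_mean r p) * nb_pmf r p k.
Proof.
move=> r0 /andP[p0 p1]; rewrite /nb_tail nb_pmf_rec// /nb_mean; field.
by rewrite gt_eqF.
Qed.

Lemma cvg0_geometric_bound (R : realType) (u : nat -> R) (rho : R) (N : nat) :
  (forall k, 0 <= u k) -> 0 <= rho < 1 ->
  (forall k, (N <= k)%N -> u k.+1 <= rho * u k) -> u n @[n --> \oo] --> 0.
Proof.
move=> u0 /andP[rho0 rho1] hu; rewrite -(cvg_shiftn N).
apply: (@squeeze_cvgr _ _ _ _ (fun=> 0) (fun n => u N * rho ^+ n)).
- apply: nearW => n; rewrite u0/=; elim: n => [|n ih]; first by rewrite mulr1 add0n.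
  rewrite addSn (le_trans (hu _ (leq_addl _ _)))// exprS mulrCA ler_wpM2l//.
- exact: cvg_cst.
- rewrite -[X in _ --> X](mulr0 (u N)); apply: cvgM; first exact: cvg_cst.
  by apply: cvg_expr; rewrite ger0_norm.
Qed.

(** The factor [n] is for the variance. The ratio of consecutive terms is
    [(k + 1) (k + r) (1 - p) / k^2], at most [(1 - p) (1 + (1 + 2 r) / k)] for [k >= 1]; this is
    below [1 - p / 2] once [k >= c]. *)
Lemma cvg_natM_nb_tail (R : realType) (r p : R) : 0 < r -> 0 < p < 1 ->
  n%:R * nb_tail r p n @[n --> \oo] --> 0.
Proof.
move=> r0 p01; have /andP[p0 p1] := p01.
have q0 : 0 < 1 - p by rewrite subr_gt0.
pose c : R := 2 * (1 - p) * (1 + 2 * r) / p.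
apply: (@cvg0_geometric_bound _ _ (1 - p / 2) (Num.trunc c).+1).
- by move=> k; rewrite mulr_ge0// nb_tail_ge0.
- by apply/andP; split; lra.
move=> k ck.
have k1 : 1 <= k%:R :> R by rewrite ler1n (leq_trans _ ck).
have {}ck : c <= k%:R.
  by apply: ltW; apply: lt_le_trans (Num.Theory.truncnS_gt c) _; rewrite ler_nat.
rewrite /c ler_pdivrMr// in ck.
rewrite /nb_tail (nb_pmf_rec p k r0).
have f0 := nb_pmf_ge0 k r0 p01; have pV : 0 <= p^-1 by rewrite invr_ge0 ltW.
rewrite (_ : k.+1%:R * _ = (k%:R + 1) * (k%:R + r) * (1 - p) * (nb_pmf r p k / p)); last first.
  by rewrite -natr1; ring.
rewrite (_ : _ * (k%:R * _) = (1 - p / 2) * k%:R * k%:R * (nb_pmf r p k / p)); last by ring.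
have fp : 0 <= nb_pmf r p k / p by exact: mulr_ge0.
apply: (ler_wpM2r fp); move: {f0 fp} (k%:R : R) k1 ck => x x1 hx.
have h1 : (x + 1) * (x + r) <= x * x + (1 + 2 * r) * x by nra.
have h2 : (x + 1) * (x + r) * (1 - p) <= (x * x + (1 + 2 * r) * x) * (1 - p).
  by rewrite ler_wpM2r// ltW.
apply: le_trans h2 _.
have h3 : 2 * (1 - p) * (1 + 2 * r) * x <= x * p * x by rewrite ler_wpM2r// (le_trans _ x1).
by lra.
Qed.

Lemma cvg_nb_tail (R : realType) (r p : R) : 0 < r -> 0 < p < 1 ->
  nb_tail r p n @[n --> \oo] --> 0.
Proof.
move=> r0 p01; apply: (squeeze_cvgr _ (cvg_cst 0) (cvg_natM_nb_tail r0 p01)).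
exists 1%N => // n /= n1; rewrite nb_tail_ge0//= ler_peMl ?nb_tail_ge0//.
by rewrite ler1n.
Qed.

Section moments.
Context (R : realType) (r p : R) (d : measure_display) (T : measurableType d).
Context (P : probability T R) (X : {RV P >-> nat}).
Hypotheses (r0 : 0 < r) (p01 : 0 < p < 1) (HX : nb_distributed r p X).

Lemma nb_expectationE (g : nat -> R) : (forall k, 0 <= g k) ->
  'E_P[fun w => g (X w)]%E = (\sum_(0 <= k <oo) (g k * nb_pmf r p k)%:E)%E.
Proof.
move=> g0; rewrite unlock.
have mX : measurable_fun setT X by [].
have mg : measurable_fun setT (fun w => (g (X w))%:E).
  by apply/measurable_EFinP; apply: (@measurableT_comp _ _ _ _ _ _ g) => //.
have e : [set: T] = \bigcup_k (X @^-1` [set k]).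
  by apply/seteqP; split => // w _; exists (X w).
have mk k : d.-measurable (X @^-1` [set k]) by rewrite -[X in _ X]setTI; exact: mX.
rewrite e ge0_integral_bigcup//=.
- apply: eq_eseriesr => k _.
  rewrite (eq_integral (fun=> (g k)%:E)); last by move=> w; rewrite inE/= => ->.
  by rewrite integral_cst// EFinM; congr (_ * _)%E; exact: HX.
- by rewrite -e.
- by move=> w _; rewrite lee_fin.
- by apply/trivIsetP => i j _ _ ij; apply/seteqP; split => // w [/= ->] /eqP; rewrite (negbTE
    ij).
Qed.

Lemma nb_expectation_cvg (g : nat -> R) (l : R) : (forall k, 0 <= g k) ->
  \sum_(0 <= k < n) g k * nb_pmf r p k @[n --> \oo] --> l ->
  'E_P[fun w => g (X w)]%E = l%:E.
Proof.
move=> g0 hl; rewrite nb_expectationE//; apply/cvg_lim => //.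
under eq_fun do rewrite sumEFin.
by apply: cvg_EFin => //; exact: nearW.
Qed.

(** Read off from [P] having total mass 1, so the binomial series is not summed. *)
Lemma cvg_sum_nb_pmf : \sum_(0 <= k < n) nb_pmf r p k @[n --> \oo] --> (1 : R).
Proof.
have h1 : (\sum_(0 <= k <oo) (1 * nb_pmf r p k)%:E)%E = 1%E.
  rewrite -(@nb_expectationE (fun=> 1))//; exact: expectation_cst.
have f0 k : (0 <= (1 * nb_pmf r p k)%:E)%E by rewrite lee_fin mul1r nb_pmf_ge0.
have := @is_cvg_nneseries R (fun k => (1 * nb_pmf r p k)%:E) xpredT 0 (fun k _ _ => f0 k).
rewrite /= => /cvg_toP/(_ h1).
under eq_fun do rewrite sumEFin.
move=> /fine_cvgP[_]; apply: cvg_trans; apply: near_eq_cvg; apply: nearW => n /=.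
by apply: eq_bigr => k _; rewrite mul1r.
Qed.

Lemma sum_centred (n : nat) :
  \sum_(0 <= k < n) (k%:R - nb_mean r p) * nb_pmf r p k = - nb_tail r p n.
Proof.
elim: n => [|n ih]; first by rewrite big_geq// nb_tail0 oppr0.
by rewrite big_nat_recr//= ih -nb_tail_diff//; ring.
Qed.

Lemma cvg_sum_nat_nb_pmf :
  \sum_(0 <= k < n) k%:R * nb_pmf r p k @[n --> \oo] --> nb_mean r p.
Proof.
have h : nb_mean r p * \sum_(0 <= k < n) nb_pmf r p k - nb_tail r p n @[n --> \oo] -->
    nb_mean r p * 1 - 0.
  apply: cvgB; last exact: cvg_nb_tail.
  by apply: cvgM; [exact: cvg_cst|exact: cvg_sum_nb_pmf].
rewrite mulr1 subr0 in h.
rewrite (_ : (fun n => _) = fun n => nb_mean r p * \sum_(0 <= k < n) nb_pmf r p k - nb_tail r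
    p n)//.
apply/funext => n; rewrite -sum_centred mulr_sumr -big_split/=.
by apply: eq_bigr => k _; ring.
Qed.

Lemma nb_expectation : 'E_P[fun w => (X w)%:R]%E = (nb_mean r p)%:E.
Proof. exact: (@nb_expectation_cvg (fun k => k%:R)) cvg_sum_nat_nb_pmf. Qed.

Lemma nb_varianceE : 'V_P[fun w => (X w)%:R]%E = (nb_variance r p)%:E.
Proof.
rewrite /variance unlock nb_expectation /=.
pose g (k : nat) : R := (k%:R - nb_mean r p) ^+ 2.
rewrite [X in ('E_P[X])%E = _](_ : _ = fun w => g (X w)); last first.
  by apply/funext => w; rewrite /g expr2.
apply: nb_expectation_cvg; first by move=> k; rewrite sqr_ge0.
(* Summation by parts: one factor [k - mu] is absorbed in [T_k - T_(k+1)], and the remaining sum of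
   the [T_k] is the truncated mean divided by [p]. *)
have sumE n : \sum_(0 <= k < n) g k * nb_pmf r p k =
    (\sum_(0 <= k < n) k%:R * nb_pmf r p k) / p - (n%:R * nb_tail r p n - (1 + nb_mean r p) *
        nb_tail r p n).
  elim: n => [|n ih]; first by rewrite !big_geq// nb_tail0; ring.
  rewrite !big_nat_recr//= ih /g expr2 -mulrA -nb_tail_diff//.
  rewrite [(_ + n%:R * _) / p]mulrDl -[n%:R * _ / p]/(nb_tail r p n) -natr1; ring.
have /andP[p0 _] := p01.
have -> : nb_variance r p = nb_mean r p / p - (0 - (1 + nb_mean r p) * 0).
  by rewrite /nb_variance /nb_mean; field; rewrite gt_eqF.
under eq_fun do rewrite sumE.
apply: cvgB; first by apply: cvgM; [exact: cvg_sum_nat_nb_pmf|exact: cvg_cst].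
apply: cvgB; first exact: cvg_natM_nb_tail.
by apply: cvgM; [exact: cvg_cst|exact: cvg_nb_tail].
Qed.

Lemma nb_mean_abs_dev (nu : nat) : nb_mean r p <= nu%:R < nb_mean r p + 1 ->
  'E_P[fun w => `|(X w)%:R - nb_mean r p|%R]%E = (2 * nb_tail r p nu)%:E.
Proof.
move=> /andP[nu1 nu2].
apply: (@nb_expectation_cvg (fun k => `|k%:R - nb_mean r p|)) => //.
(* Below [nu] the deviations are negative and telescope from [T_0 = 0] up to [T_nu]; from [nu] on
   the sign flips and they contribute [T_nu] once more, less a vanishing tail. *)
have s1 n : (n <= nu)%N ->
    \sum_(0 <= k < n) `|k%:R - nb_mean r p| * nb_pmf r p k = nb_tail r p n.
  elim: n => [|n ih] nnu; first by rewrite big_geq// nb_tail0.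
  rewrite big_nat_recr//= ih ?(ltnW nnu)// ler0_norm; last first.
    have : n.+1%:R <= nu%:R :> R by rewrite ler_nat.
    by rewrite -natr1; lra.
  by rewrite mulNr -nb_tail_diff//; ring.
have s2 n : \sum_(0 <= k < nu + n) `|k%:R - nb_mean r p| * nb_pmf r p k =
    2 * nb_tail r p nu - nb_tail r p (nu + n).
  elim: n => [|n ih]; first by rewrite addn0 s1//; ring.
  rewrite addnS big_nat_recr//= ih ger0_norm; last first.
    by rewrite subr_ge0 (le_trans nu1)// ler_nat leq_addr.
  by rewrite -nb_tail_diff//; ring.
rewrite -(cvg_shiftn nu).
under eq_fun do rewrite addnC s2 addnC.
have h : 2 * nb_tail r p nu - nb_tail r p (n + nu) @[n --> \oo] --> 2 * nb_tail r p nu - 0.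
  apply: cvgB; first exact: cvg_cst.
  by rewrite (cvg_shiftn nu (nb_tail r p)); exact: cvg_nb_tail.
by rewrite subr0 in h.
Qed.

End moments.

(** * The exact Gamma quotient, the compact set and the first coefficients *)

Lemma nb_shift_itv (R : realType) (r p : R) : 0 <= nb_shift r p < 1.
Proof.
have /andP[] := Num.Theory.ceil_itv (nb_mean r p).
by rewrite intrD /nb_shift subr_ge0 => h ->/=; rewrite ltrBlDr addrC -ltrBlDr.
Qed.

Lemma nb_mean_shift_nat (R : realType) (r p : R) : 0 < r -> 0 < p < 1 ->
  exists2 nu : nat, (0 < nu)%N & nu%:R = nb_mean r p + nb_shift r p.
Proof.
move=> r0 /andP[p0 p1].
have mu0 : 0 < nb_mean r p by rewrite divr_gt0// mulr_gt0// subr_gt0.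
have c0 : (0 < Num.ceil (nb_mean r p)) by rewrite Num.Theory.ceil_gt0.
exists `|Num.ceil (nb_mean r p)|%N; first by rewrite absz_gt0 gt_eqF.
by rewrite /nb_shift subrKC pmulrn gez0_abs// ltW.
Qed.

Lemma expR_half_ln (R : realType) (x : R) : 0 < x -> expR (ln x / 2) = Num.sqrt x.
Proof.
by move=> x0; rewrite mulrC -ln_powR lnK ?posrE ?powR_gt0// powR12_sqrt// ltW.
Qed.

Lemma nb_ratioE (R : realType) (r p h : R) (nu : nat) : 0 < r -> 0 < p < 1 -> (0 < nu)%N ->
  nu%:R = nb_mean r p + h ->
  2 * nb_tail r p nu * (p^-1 * Num.sqrt (2 * r * (1 - p) / pi))^-1 = expR (ln_nb_ratio r p h).
Proof.
move=> r0 /andP[p0 p1] nu0 nuE.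
have q0 : 0 < 1 - p by rewrite subr_gt0.
have rq0 : 0 < r * (1 - p) by rewrite mulr_gt0.
have pi0 := pi_gt0 R.
have nuR0 : 0 < nu%:R :> R by rewrite ltr0n.
rewrite /ln_nb_ratio -/(nb_mean r p) -nuE.
have -> : r / p + h = nu%:R + r.
  by rewrite nuE /nb_mean; field; rewrite gt_eqF.
rewrite !(expRD, expRN) !expR_lnGamma ?addr_gt0// expRM_natl lnK ?posrE//.
rewrite !expR_half_ln ?mulr_gt0//.
have -> : expR (r * ln p) = p `^ r by rewrite /powR gt_eqF.
(* Everything is expressed through [s] and the root of [r (1 - p)], with [pi = s^2 / 2], so that the
   identity becomes rational and [field] applies. *)
set s := Num.sqrt (2 * pi).
have s0 : 0 < s by rewrite sqrtr_gt0 mulr_gt0.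
have piE : pi = s ^+ 2 / 2 by rewrite sqr_sqrtr ?mulr_ge0 ?(ltW pi0)// mulrAC divff// mul1r.
have -> : Num.sqrt (2 * r * (1 - p) / pi) = s * Num.sqrt (r * (1 - p)) / pi.
  have aux (x : R) : 0 < x -> 2 * r * (1 - p) / x = (2 * x) * (r * (1 - p)) * x^-1 ^+ 2.
    by move=> x0; field; rewrite gt_eqF.
  rewrite (aux _ pi0).
  have twopi0 : 0 <= 2 * pi :> R by rewrite mulr_ge0// ltW.
  rewrite [LHS]sqrtrM; last by rewrite mulr_ge0// ltW.
  rewrite [X in _ * X]sqrtr_sqr ger0_norm; last by rewrite invr_ge0 ltW.
  by rewrite [X in X / _ = _]sqrtrM.
rewrite piE /nb_tail /nb_pmf (GammaD1 nuR0).
have t0 : 0 < Num.sqrt (r * (1 - p)) by rewrite sqrtr_gt0.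
have G1 := Gamma_gt0 r0; have G2 := Gamma_gt0 nuR0.
move: (Num.sqrt (r * (1 - p))) t0 (Gamma r) G1 (Gamma nu%:R) G2 (Gamma (nu%:R + r)) => t t0 a
    a0 b b0 c.
move: (nu%:R : R) nuR0 ((1 - p) ^+ nu) (p `^ r) s s0 {piE nuE} => n n0 u v s s0.
field.
by rewrite !gt_eqF.
Qed.

(** The minimum of [p (1 - p)] over the compact set serves as [e], since this product is at most
    each of its factors. *)
Lemma compact_itv01_bound (R : realType) (A : set R) : compact A -> A `<=` `]0, 1[ ->
  exists e : R, [/\ 0 < e, e <= 1 & forall p, A p -> e <= p /\ e <= 1 - p].
Proof.
move=> cA A01; have [->|A0] := eqVneq A set0; first by exists 1; split.
have cf : {within A, continuous (fun p : R => p * (1 - p))}.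
  apply: continuous_subspaceT => x; apply: cvgM; first exact: cvg_id.
  by apply: cvgB; [exact: cvg_cst|exact: cvg_id].
move/set0P in A0; have [c /set_mem Ac cmin] := compact_EVT_min A0 cA cf.
have := A01 c Ac; rewrite /= in_itv/= => /andP[c0 c1].
exists (c * (1 - c)); split; first by rewrite mulr_gt0// subr_gt0.
  by nra.
move=> p Ap; have := A01 p Ap; rewrite /= in_itv/= => /andP[p0 p1].
have := cmin p (mem_set Ap) => h.
by split; apply: le_trans h _; nra.
Qed.

Lemma bernoulli_egf_at0 (R : realType) :
  [/\ bernoulli_egf (0 : R) 2 = 12^-1, bernoulli_egf (0 : R) 3 = 0 &
      bernoulli_egf (0 : R) 4 = - 720^-1].
Proof.
have f (n m : nat) : n`! = m -> (n`!)%:R = m%:R :> R by move=> ->.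
have b2 : bernoulli_egf (0 : R) 2 = 12^-1.
  have := bernoulli_egf_rec (0 : R) 2.
  rewrite !big_ord_recr big_ord0/= bernoulli_egf0 bernoulli_egf1 expr0n mulr0.
  rewrite (f 3%N 6%N)// (f 2%N 2%N)// (f 1%N 1%N)//; lra.
have b3 : bernoulli_egf (0 : R) 3 = 0.
  have := bernoulli_egf_rec (0 : R) 3.
  rewrite !big_ord_recr big_ord0/= bernoulli_egf0 bernoulli_egf1 expr0n mulr0 b2.
  rewrite (f 4%N 24%N)// (f 3%N 6%N)// (f 2%N 2%N)// (f 1%N 1%N)//; lra.
split=> //.
have := bernoulli_egf_rec (0 : R) 4.
rewrite !big_ord_recr big_ord0/= bernoulli_egf0 bernoulli_egf1 expr0n mulr0 b2 b3.
rewrite (f 5%N 120%N)// (f 4%N 24%N)// (f 3%N 6%N)// (f 2%N 2%N)// (f 1%N 1%N)//; lra.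
Qed.

Theorem theorem5p1 (R : realType) (PP : set R)
    (PP_compact : compact PP) (PP_sub : PP `<=` `]0, 1[) :
  [/\ (* the asymptotic expansion, uniform over PP *)
      forall M : nat, exists C r0 : R,
        forall r p : R, 0 < r -> r0 <= r -> PP p ->
        forall (d : measure_display) (T : measurableType d)
          (P : probability T R) (X : {RV P >-> nat}),
        nb_distributed r p X ->
        let q := 1 - p in
        let mu := nb_mean r p in
        let h := nb_shift r p in
        let dm := exp_coef (fun n => atilde n h p) in
        (`| 'E_P[fun w => `|(X w)%:R - mu|%R] *
              ((p^-1 * Num.sqrt (2 * r * q / pi))^-1)%:E
            - (\sum_(n < M.+1) dm n / r ^+ n)%:E |
         <= (C * r ^- M.+1)%:E)%E,
      (* the meaning of mu, sigma^2 and h *)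
      forall r p : R, 0 < r -> PP p ->
        [/\ forall (d : measure_display) (T : measurableType d)
              (P : probability T R) (X : {RV P >-> nat}),
              nb_distributed r p X ->
              'E_P[fun w => (X w)%:R]%E = (nb_mean r p)%:E /\
              'V_P[fun w => (X w)%:R]%E = (nb_variance r p)%:E,
            0 <= nb_shift r p < 1 &
            p^-1 * Num.sqrt (2 * r * (1 - p) / pi)
            = Num.sqrt (2 * nb_variance r p / pi)]
    & (* the first three coefficients *)
      forall p h : R, PP p -> 0 <= h < 1 ->
        let q := 1 - p in
        let B k := (bernoulli_poly R k).[h] in
        [/\ atilde 1 h p = - (1 / 12) - p ^+ 2 / (2 * q) * B 2%N,
            atilde 2 h p = p ^+ 3 * (1 + q) / (6 * q ^+ 2) * B 3%N &
            atilde 3 h p = 1 / 360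
              - p ^+ 4 * (1 + q + q ^+ 2) / (12 * q ^+ 3) * B 4%N]].
Proof.
have [e [e0 e1 he]] := compact_itv01_bound PP_compact PP_sub.
have p01 p : PP p -> 0 < p < 1 by move=> /PP_sub; rewrite /= in_itv.
split.
- move=> M; have [C [r1 hC]] := nb_ratio_expansion M e0 e1.
  exists C, r1 => r p r0 r1r PPp d T P X HX /=.
  have [ep eq] := he p PPp; have hs := nb_shift_itv r p.
  have /andP[hs0 hs1] := hs.
  have hs01 : 0 <= nb_shift r p <= 1 by rewrite hs0 ltW.
  have [nu nu0 nuE] := nb_mean_shift_nat r0 (p01 p PPp).
  rewrite (nb_mean_abs_dev r0 (p01 p PPp) HX (nu := nu)); last first.
    by rewrite nuE lerDl hs0 ltrD2l.
  rewrite -EFinM -EFinB abse_EFin lee_fin (nb_ratioE r0 (p01 p PPp) nu0 nuE).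
  exact: hC.
- move=> r p r0 PPp; have /andP[p0 p1] := p01 p PPp; split.
  + move=> d T P X HX; split; first exact: nb_expectation (p01 p PPp) HX.
    exact: nb_varianceE (p01 p PPp) HX.
  + exact: nb_shift_itv.
  + have -> : 2 * nb_variance r p / pi = p^-1 ^+ 2 * (2 * r * (1 - p) / pi).
      rewrite /nb_variance; have := pi_gt0 R; move: (pi : R) => x x0.
      by field; rewrite !gt_eqF.
    rewrite [RHS]sqrtrM ?sqr_ge0// [X in _ = X * _]sqrtr_sqr ger0_norm//.
    by rewrite invr_ge0 ltW.
- move=> p h PPp h01 /=; have /andP[p0 p1] := p01 p PPp.
  have q0 : 1 - p != 0 by rewrite gt_eqF// subr_gt0.
  have [b2 b3 b4] := bernoulli_egf_at0 R.
  have f (n m : nat) : n`! = m -> (n`!)%:R = m%:R :> R by move=> ->.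
  (* The constant terms are [- (-1)^j j! b_(j+2)(0)] for [j] = 0, 1, 2, that is [-1/12], 0 and
     [2/720]. *)
  rewrite !atilde_bernoulli b2 b3 b4 /bernoulli_egf.
  rewrite (f 4%N 24%N)// (f 3%N 6%N)// (f 2%N 2%N)// (f 1%N 1%N)//.
  by split; field.
Qed.
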